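(* Let $x=\langle a_1,a_2,a_3,\dots\rangle\in[0,1)$ be an irrational number that is CF-normal. Then for any integers $k\ge 1$ and $m\ge 2$, the number $y=\langle a_k, a_{m+k}, a_{2m+k}, a_{3m+k},\dots\rangle$ is not CF-normal. In fact, for any integers $k\ge 1$, $m\ge 2$, the limit \[ \lim_{n\to\infty}\frac{\#\{1\le i\le n : a_{(i-1)m+k}=a_{im+k}=1\}}{n} \] exists but does not equal $\mu(C_{[1,1]})$.
   Context: Every irrational $x\in[0,1)$ has a unique infinite continued fraction expansion $x=\cfrac{1}{a_1+\cfrac{1}{a_2+\cdots}}=\langle a_1,a_2,a_3,\dots\rangle$ with $a_i$ positive integers. The Gauss map is $T x = x^{-1}-\lfloor x^{-1}\rfloor$ (and $T0=0$); it acts as the shift $T\langle a_1,a_2,\dots\rangle=\langle a_2,a_3,\dots\rangle$. The Gauss measure on $[0,1)$ is $\mu(A)=\int_A \frac{dx}{(1+x)\log 2}$. For a finite string $s=[d_1,\dots,d_k]$ of positive integers, the cylinder set $C_s$ is the set of $x\in[0,1)$ whose first $k$ continued fraction digits are $d_1,\dots,d_k$. A number $x\in[0,1)$ is called CF-normal if for every finite non-empty string $s$ of positive integers, \[ \lim_{n\to\infty}\frac{\#\{0\le i\le n: T^i x\in C_s\}}{n}=\mu(C_s), \] i.e. the limiting frequency of $s$ as a block of consecutive digits in the expansion of $x$ equals $\mu(C_s)$. *)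

(* Defs.v *)
From mathcomp Require Export all_boot all_order all_algebra.
From mathcomp Require Export all_classical all_reals all_analysis.

Set Implicit Arguments.
Unset Strict Implicit.
Unset Printing Implicit Defensive.

Import Order.TTheory GRing.Theory Num.Theory.
Import numFieldNormedType.Exports.

Local Open Scope classical_set_scope.
Local Open Scope ring_scope.

(** Digit sequences [a : nat -> nat] are indexed from 1, so [a 0] is never
    used. *)

Definition cf_fin (R : realType) (s : seq nat) : R :=
  foldr (fun d z => (d%:R + z)^-1) 0 s.

(** The value of <a 1, a 2, a 3, ...>.  The limit exists whenever all the
    digits are positive. *)
Definition cf (R : realType) (a : nat -> nat) : R :=
  limn (fun n : nat => cf_fin R [seq a i | i <- iota 1 n]).

(** [0^-1 = 0], so that [gauss_map 0 = 0]. *)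
Definition gauss_map (R : realType) (x : R) : R :=
  x^-1 - (Num.floor x^-1)%:~R.

(** The [i]-th continued fraction digit, [1 <= i]: the integer part of
    [1 / T^(i-1) x].  For a rational [x] in [0, 1) this yields the finite
    expansion whose last digit is at least 2, padded with zeros; the padding
    never matches a string of positive integers. *)
Definition cf_digit (R : realType) (x : R) (i : nat) : nat :=
  Num.truncn (iter i.-1 (@gauss_map R) x)^-1.

Definition cylinder (R : realType) (s : seq nat) : set R :=
  [set x | 0 <= x < 1 /\ [seq cf_digit x i | i <- iota 1 (size s)] = s].
Arguments cylinder R s : clear implicits.

(** Meaningful for [A] a Borel subset of [0, 1). *)
Definition gauss_measure (R : realType) (A : set R) : R :=
  \int[@lebesgue_measure R]_(x in A) ((1 + x) * ln 2)^-1.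

(** The convention [x \in [0, 1)] is not part of the definition. *)
Definition CF_normal (R : realType) (x : R) : Prop :=
  forall s : seq nat, s != [::] -> all (fun d => 0 < d)%N s ->
    (count (fun i : nat => iter i (@gauss_map R) x \in cylinder R s)
       (iota 0 n.+1))%:R / n%:R @[n --> \oo] --> gauss_measure (cylinder R s).

(* Main.v *)
Require Import Defs.
From mathcomp Require Import ring lra zify measurable_realfun.

Set Implicit Arguments.
Unset Strict Implicit.
Unset Printing Implicit Defensive.

Import Order.TTheory GRing.Theory Num.Theory.
Import numFieldNormedType.Exports.

Local Open Scope classical_set_scope.
Local Open Scope ring_scope.

(** Normality makes the density of {j : a_j = a_(j+m) = 1} equal to
    l = sum_w mu(C_(1 w 1)), where w runs over the words of length m - 1.

    The same density is found along the progression j = k mod m.  Reading the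
    digits of a Lebesgue random point is a Markov chain on the ratios
    q_(i-1) / q_i, whose transition operator reverses monotonicity and halves
    the oscillation of monotone functions.  Hence the correlations of the event
    "d_i = d_(i+m) = 1" decay exponentially and its sums over blocks of length L
    have variance O(L), even with bounded weights.  Normality transfers this
    bound to the orbit of x, and cutting the orbit into blocks of length L shows
    that averages against an m-periodic weight of mean zero tend to 0.

    Finally l > mu(C_(1 1)): whatever the word v, the second digit after v is 1
    with conditional probability at least 3/8, so l >= 3/8 mu(C_1), while
    mu(C_(1 1)) < 3/8 mu(C_1) because (10/9)^8 < (4/3)^3. *)

(** Normality gives only the frequencies of single finite words, while digits are unbounded. Every
    limit is therefore approached through words with digits below a level D; windows that contain a
    larger digit are charged to [tails], whose density for windows of length N is at most 2 N / D.
    The chain starts at ratio 0, that is with Lebesgue instead of Gauss measure, since its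
    transition probabilities are then explicit; the Gauss measure is at most twice as large, and
    only upper bounds of nonnegative quantities pass from one to the other. In place of the
    stationary mean of the truncated chain, block sums are centred at a constant that depends on D
    and on the block length L. This does no harm, because the partial sums of the periodic weight
    are bounded. The weights met by a block depend on its start modulo m, which word frequencies do
    not see; so the squares for all m phases are added up. L is chosen first, against the variance,
    and D afterwards in terms of L. *)

Notation posw := (all (fun d => 0 < d)%N).

(** * Inverse branches of the Gauss map and conditional Lebesgue probabilities *)

Definition branch (R : realType) (s : seq nat) (y : R) : R :=
  foldr (fun d z => (d%:R + z)^-1) y s.

(* If x = q_(k-1) / q_k is formed from the digits already read, then
   digit_prob d x is the conditional Lebesgue probability that the next digit
   is d, after which the new ratio is 1 / (d + x). *)
Definition digit_prob (R : realType) (d : nat) (x : R) : R :=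
  (1 + x) / ((d%:R + x) * (d%:R + 1 + x)).

Fixpoint word_prob (R : realType) (x : R) (s : seq nat) : R :=
  if s is d :: s' then digit_prob d x * word_prob (d%:R + x)^-1 s' else 1.

(** A conditional distribution function: if the digits already read give the ratio x, the remainder
    is at most t with conditional Lebesgue probability [ratio_map x t]. *)
Definition ratio_map (R : realType) (x t : R) : R := t * (1 + x) / (1 + x * t).

Section Branches.
Variable R : realType.
Implicit Types (x y z : R) (s : seq nat) (d : nat).

Lemma natr_ge1 d : (0 < d)%N -> 1 <= d%:R :> R.
Proof. by rewrite ler1n. Qed.

Lemma inv01 d y : (0 < d)%N -> 0 <= y <= 1 -> 0 <= (d%:R + y)^-1 <= 1.
Proof.
move=> /natr_ge1 d1 /andP[y0 y1].
by rewrite invr_ge0 invf_le1; lra.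
Qed.

Lemma branch01 s y : posw s -> 0 <= y <= 1 -> 0 <= branch s y <= 1.
Proof. by elim: s => //= d s ih /andP[d0 ps] y01; apply: inv01 (ih ps y01). Qed.

Lemma branch_cat s t y : branch (s ++ t) y = branch s (branch t y).
Proof. exact: foldr_cat. Qed.

Lemma digit_prob_ge0 d x : 0 <= x -> 0 <= digit_prob d x.
Proof.
move=> x0; have d0 : 0 <= d%:R :> R by [].
by rewrite /digit_prob divr_ge0 ?mulr_ge0; lra.
Qed.

Lemma digit_prob_le_half d x : (0 < d)%N -> 0 <= x <= 1 -> digit_prob d x <= 2^-1.
Proof.
move=> /natr_ge1 d1 /andP[x0 x1].
rewrite /digit_prob ler_pdivrMr; last by apply: mulr_gt0; lra.
by nra.
Qed.

Lemma word_prob_ge0 s x : posw s -> 0 <= x <= 1 -> 0 <= word_prob x s.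
Proof.
elim: s x => //= d s ih x /andP[d0 ps] x01.
by rewrite mulr_ge0 ?digit_prob_ge0 ?ih ?inv01 //; case/andP: x01.
Qed.

(** On the remainders that start with d the conditional law has the same form, with ratio 1 / (d +
    x) and total mass [digit_prob d x]. The sign appears because t -> 1 / (d + t) reverses the
    order. *)
Lemma ratio_map_step d x t u : (0 < d)%N -> 0 <= x <= 1 -> 0 <= t <= 1 -> 0 <= u <= 1 ->
  ratio_map x (d%:R + t)^-1 - ratio_map x (d%:R + u)^-1 =
  - (digit_prob d x * (ratio_map (d%:R + x)^-1 t - ratio_map (d%:R + x)^-1 u)).
Proof.
move=> /natr_ge1 d1 /andP[x0 x1] /andP[t0 t1] /andP[u0 u1].
rewrite /ratio_map /digit_prob; field.
by rewrite !gt_eqF //; lra.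
Qed.

(** Each digit contributes a factor [digit_prob], which is at most 1/2. The ratio is kept general
    because it changes along the word; [branch_dist] is the case x = 0. *)
Lemma ratio_map_branch_dist s x y z : posw s -> 0 <= x <= 1 -> 0 <= y <= 1 -> 0 <= z <= 1 ->
  `|ratio_map x (branch s y) - ratio_map x (branch s z)| <= 2^-1 ^+ size s.
Proof.
move=> ps + y01 z01; elim: s ps x => [_ x /andP[x0 x1]|d s ih /= /andP[d0 ps] x x01].
  have F01 t : 0 <= t <= 1 -> 0 <= ratio_map x t <= 1.
    move=> /andP[t0 t1]; rewrite /ratio_map divr_ge0 ?ler_pdivrMr; nra.
  have /andP[? ?] := F01 _ y01; have /andP[? ?] := F01 _ z01.
  by rewrite /= expr0 ler_norml; lra.
rewrite ratio_map_step ?branch01 // normrN normrM exprS ler_pM //.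
  by rewrite ger0_norm ?digit_prob_le_half // digit_prob_ge0 //; case/andP: x01.
by rewrite ih // inv01.
Qed.

Lemma branch_dist s y z : posw s -> 0 <= y <= 1 -> 0 <= z <= 1 ->
  `|branch s y - branch s z| <= 2^-1 ^+ size s.
Proof.
move=> ps y01 z01; have := ratio_map_branch_dist ps _ y01 z01 (x := 0).
by rewrite /ratio_map !mul0r !addr0 !mulr1 !divr1; apply; rewrite lexx ler01.
Qed.

Lemma ratio_map_branch_word_prob s x : posw s -> 0 <= x <= 1 ->
  `|ratio_map x (branch s 1) - ratio_map x (branch s 0)| = word_prob x s.
Proof.
elim: s x => [x _ /andP[x0 x1]|d s ih x /= /andP[d0 ps] x01].
  by rewrite /ratio_map /= !mul0r subr0 mulr1 mul1r divff ?normr1 // gt_eqF //; lra.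
rewrite ratio_map_step ?branch01 ?lexx ?ler01 // normrN normrM ih ?inv01 //.
by rewrite ger0_norm // digit_prob_ge0 //; case/andP: x01.
Qed.

Lemma branch_word_prob s : posw s -> `|branch s 1 - branch s 0| = word_prob (0 : R) s.
Proof.
move=> ps; have := ratio_map_branch_word_prob (x := 0) ps; rewrite lexx ler01 => /(_ isT) <-.
by rewrite /ratio_map !mul0r !addr0 !mulr1 !divr1.
Qed.

End Branches.

(** * Digits and Gauss orbit of a number given by its expansion *)

Section CFValue.
Variable R : realType.
Implicit Types (a : nat -> nat).

Lemma posw_map a (s : seq nat) : (forall i, (0 < i)%N -> (0 < a i)%N) ->
  posw s -> posw [seq a i | i <- s].
Proof. by move=> a0 ps; rewrite all_map; apply: sub_all ps => i /a0. Qed.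

Lemma posw_iota i n : (0 < i)%N -> posw (iota i n).
Proof. by move=> i0; apply/allP => j; rewrite mem_iota; lia. Qed.

Lemma cf_is_cvg a : (forall i, (0 < i)%N -> (0 < a i)%N) ->
  cvgn (fun n : nat => cf_fin R [seq a i | i <- iota 1 n]).
Proof.
move=> a0; apply/cauchy_cvgP; apply: cauchy_exP => e e0.
have [N _ hN] : \forall n \near \oo, (2^-1 : R) ^+ n < e.
  have : (2^-1 : R) ^+ n @[n --> \oo] --> (0 : R).
    by apply: cvg_expr; rewrite ger0_norm; lra.
  by move/cvgrPdist_lt/(_ _ e0); apply: filterS => n; rewrite sub0r normrN ger0_norm.
exists (cf_fin R [seq a i | i <- iota 1 N]).
exists N => // n /= leNn; rewrite /ball /=.
(* A longer fraction is the branch of the first N digits applied to a point of [0, 1]; the fraction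
   cut at N is the same branch applied to 0. *)
rewrite -(subnKC leNn) iotaD map_cat [cf_fin R (_ ++ _)]branch_cat.
apply: le_lt_trans (hN _ (leqnn N)).
have := @branch_dist R [seq a i | i <- iota 1 N] 0.
rewrite size_map size_iota; apply; rewrite ?lexx ?ler01 //.
  by rewrite posw_map ?posw_iota.
by apply: branch01; rewrite ?lexx ?ler01 // posw_map ?posw_iota.
Qed.

Lemma cf_ge0_le1 a : (forall i, (0 < i)%N -> (0 < a i)%N) -> 0 <= cf R a <= 1.
Proof.
move=> a0; have ca := cf_is_cvg a0.
have b n : 0 <= cf_fin R [seq a i | i <- iota 1 n] <= 1.
  by apply: branch01; rewrite ?lexx ?ler01 // posw_map ?posw_iota.
apply/andP; split.
  by apply: limr_ge => //; near=> n; have /andP[] := b n.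
by apply: limr_le => //; near=> n; have /andP[] := b n.
Unshelve. all: by end_near. Qed.

Lemma cf_cons a : (forall i, (0 < i)%N -> (0 < a i)%N) ->
  cf R a = ((a 1%N)%:R + cf R (fun i => a i.+1))^-1.
Proof.
move=> a0; set b := fun i => a i.+1.
have b0 i : (0 < i)%N -> (0 < b i)%N by move=> _; apply: a0.
have cb := cf_is_cvg b0; have /andP[c0 _] := cf_ge0_le1 b0.
apply/cvg_lim => //; rewrite -cvg_shiftS.
have a1 : 1 <= (a 1%N)%:R :> R by rewrite natr_ge1 // a0.
have -> : (fun n => cf_fin R [seq a i | i <- iota 1 n.+1]) =
          (fun n => ((a 1%N)%:R + cf_fin R [seq b i | i <- iota 1 n])^-1).
  by apply/funext => n /=; rewrite (iotaDl 1 1) -map_comp.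
by apply: cvgV; [rewrite gt_eqF //; lra|apply: cvgD => //; exact: cvg_cst].
Qed.

(** Strict bounds let the integer part recover the first digit exactly. Positivity of all tails
    comes first: 1 / (1 + z) < 1 requires z > 0. *)
Lemma cf_gt0_lt1 a : (forall i, (0 < i)%N -> (0 < a i)%N) -> 0 < cf R a < 1.
Proof.
have pos b : (forall i, (0 < i)%N -> (0 < b i)%N) -> 0 < cf R b.
  move=> b0; rewrite cf_cons // invr_gt0.
  have := @cf_ge0_le1 (fun i => b i.+1) (fun i _ => b0 i.+1 isT) => /andP[? _].
  by have := natr_ge1 R (b0 1%N isT); lra.
move=> a0; rewrite pos //= cf_cons //.
have := pos (fun i => a i.+1) (fun i _ => a0 i.+1 isT).
by have := natr_ge1 R (a0 1%N isT) => ? ?; rewrite invf_lt1; lra.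
Qed.

Lemma truncn_natD d (z : R) : 0 <= z < 1 -> Num.truncn (d%:R + z) = d.
Proof. by move=> z01; apply: truncn_def; rewrite -natr1; lra. Qed.

Lemma gauss_map_inv d (z : R) : (0 <= z < 1) -> gauss_map (d%:R + z)^-1 = z.
Proof.
move=> z01; rewrite /gauss_map invrK.
rewrite (@floor_def _ _ (Posz d)); last first.
  by rewrite intrD -!pmulrn; lra.
by rewrite -pmulrn; lra.
Qed.

Lemma iter_gauss_cf a i : (forall i, (0 < i)%N -> (0 < a i)%N) ->
  iter i (@gauss_map R) (cf R a) = cf R (fun j => a (i + j)%N).
Proof.
move=> a0; elim: i => [|i ih]; first by [].
rewrite iterS ih cf_cons; last by move=> j j0; rewrite a0 // addn_gt0 j0 orbT.
rewrite gauss_map_inv; last first.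
  have /andP[? ?] : 0 < cf R (fun j => a (i + j.+1)%N) < 1.
    by apply: cf_gt0_lt1 => j j0; rewrite a0 // addn_gt0 orbT.
  by apply/andP; split; lra.
by congr (cf R _); apply/funext => j; rewrite addSnnS.
Qed.

Lemma cf_digit_cf a i : (forall i, (0 < i)%N -> (0 < a i)%N) -> (0 < i)%N ->
  cf_digit (cf R a) i = a i.
Proof.
move=> a0; case: i => // i _; rewrite /cf_digit /= iter_gauss_cf // cf_cons; last first.
  by move=> j j0; rewrite a0 // addn_gt0 j0 orbT.
rewrite invrK truncn_natD ?addn1 //.
have /andP[? ?] : 0 < cf R (fun j => a (i + j.+1)%N) < 1.
  by apply: cf_gt0_lt1 => j j0; rewrite a0 // addn_gt0 orbT.
by apply/andP; split; lra.
Qed.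

Lemma iter_gauss_cylinder a i s : (forall i, (0 < i)%N -> (0 < a i)%N) ->
  (iter i (@gauss_map R) (cf R a) \in cylinder R s) =
  ([seq a j | j <- iota i.+1 (size s)] == s).
Proof.
move=> a0; rewrite iter_gauss_cf //.
have b0 j : (0 < j)%N -> (0 < a (i + j))%N by move=> j0; rewrite a0 // addn_gt0 j0 orbT.
have e : [seq cf_digit (cf R (fun j => a (i + j)%N)) j | j <- iota 1 (size s)] =
         [seq a j | j <- iota i.+1 (size s)].
  rewrite -[i.+1]addn1 iotaDl -map_comp; apply/eq_in_map => j; rewrite mem_iota => /andP[j0 _].
  by rewrite cf_digit_cf.
apply/idP/eqP => [/set_mem[_]|es]; first by rewrite e.
apply/mem_set; split; last by rewrite e.
by have /andP[/ltW -> ->] := cf_gt0_lt1 b0.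
Qed.

End CFValue.

(** * Cylinders as intervals, and their Gauss measure *)

Definition cyl_prob (R : realType) (s : seq nat) : R :=
  `|ln (1 + branch s 1) - ln (1 + branch s 0)| / ln 2.

Section CylinderMeasure.
Variable R : realType.
Implicit Types (x y z u v : R) (s : seq nat) (d : nat).

(** The condition [x < 1] excludes exactly the case d = 1, z = 0, where 1 / (d + z) = 1. *)
Lemma cylinder_consP d s x : (0 < d)%N ->
  cylinder R (d :: s) x <->
  x < 1 /\ exists2 z, cylinder R s z & x = (d%:R + z)^-1.
Proof.
move=> d0; have d1 := natr_ge1 R d0.
have E z : 0 <= z < 1 -> [seq cf_digit (d%:R + z)^-1 i | i <- iota 1 (size s).+1]
     = d :: [seq cf_digit z i | i <- iota 1 (size s)].
  move=> z01; rewrite /= {1}/cf_digit /= invrK truncn_natD //; congr (_ :: _).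
  rewrite -[2%N]/(1 + 1)%N iotaDl -map_comp; apply/eq_in_map => i.
  rewrite mem_iota => /andP[i0 _] /=; rewrite /cf_digit /=.
  by rewrite -(prednK i0) iterSr gauss_map_inv.
split=> [[/andP[x0 x1] xs]|[x1 [z [z01 zs] xz]]]; last subst x.
  split=> //; have xV0 : 0 <= x^-1 by rewrite invr_ge0.
  have dE : Num.truncn x^-1 = d by case: xs.
  have := truncn_itv xV0; rewrite dE -natr1 => dx.
  have xz : x = (d%:R + (x^-1 - d%:R))^-1 by rewrite subrKC invrK.
  exists (x^-1 - d%:R) => //; split; first by apply/andP; split; lra.
  by move: xs; rewrite {1}xz E => [[] //|]; apply/andP; split; lra.
split; last by rewrite [size _]/= E // zs.
by case/andP: z01 => z0 _; rewrite invr_ge0; apply/andP; split=> //; lra.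
Qed.

(** The sign of (u - z) (z - v) says whether z lies between u and v in whichever order. Each
    inversion preserves it, so the orientation of a cylinder, which alternates with the length of
    the word, does not have to be tracked. *)
Lemma inv_between d u v z : (0 < d)%N -> 0 <= u -> 0 <= v -> 0 <= z ->
  ((d%:R + u)^-1 - (d%:R + z)^-1) * ((d%:R + z)^-1 - (d%:R + v)^-1) =
  (u - z) * (z - v) / ((d%:R + u) * (d%:R + v) * (d%:R + z) ^+ 2).
Proof.
move=> /(natr_ge1 R) d1 u0 v0 z0; field.
by rewrite !gt_eqF //; lra.
Qed.

Lemma cylinder_between s x : posw s -> cylinder R s x ->
  0 <= (branch s 1 - x) * (x - branch s 0).
Proof.
elim: s x => [|d s ih] x /=.
  by move=> _ [/andP[x0 x1] _]; rewrite mulr_ge0; lra.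
move=> /andP[d0 ps] /cylinder_consP-/(_ d0)[x1 [z zs ->]].
have /andP[b10 b11] := @branch01 R s 1 ps (introT andP (conj ler01 (lexx _))).
have /andP[b00 b01] := @branch01 R s 0 ps (introT andP (conj (lexx _) ler01)).
have /andP[z0 _] := zs.1; have d1 := natr_ge1 R d0.
rewrite inv_between // divr_ge0 ?ih // !mulr_ge0 ?exprn_ge0; lra.
Qed.

Lemma between_cylinder s x : posw s ->
  0 < (branch s 1 - x) * (x - branch s 0) -> cylinder R s x.
Proof.
elim: s x => [|d s ih] x /=.
  by move=> _ x01; split=> //; apply/andP; split; nra.
move=> /andP[d0 ps] xb.
have /andP[b10 b11] := @branch01 R s 1 ps (introT andP (conj ler01 (lexx _))).
have /andP[b00 b01] := @branch01 R s 0 ps (introT andP (conj (lexx _) ler01)).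
have d1 := natr_ge1 R d0.
set p := (d%:R + branch s 1)^-1 in xb; set q := (d%:R + branch s 0)^-1 in xb.
have pd : p <= d%:R^-1 by rewrite /p lef_pV2 ?posrE; lra.
have qd : q <= d%:R^-1 by rewrite /q lef_pV2 ?posrE; lra.
have p0 : 0 < p by rewrite /p invr_gt0; lra.
have q0 : 0 < q by rewrite /q invr_gt0; lra.
have dV : d%:R^-1 <= 1 :> R by rewrite invf_le1; lra.
have [x0 xd] : 0 < x /\ x < d%:R^-1 by split; nra.
have xV : d%:R < x^-1 by rewrite -[ltLHS]invrK ltf_pV2 ?posrE ?invr_gt0 //; lra.
apply/cylinder_consP => //; split; first by lra.
have [z z0 xz] : exists2 z, 0 <= z & x = (d%:R + z)^-1.
  by exists (x^-1 - d%:R); rewrite ?subrKC ?invrK //; lra.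
exists z => //; apply: ih => //.
move: xb; rewrite xz inv_between // pmulr_lgt0 // invr_gt0.
by apply: mulr_gt0; [apply: mulr_gt0|apply: exprn_gt0]; lra.
Qed.

Lemma ln2_ge_half : 2^-1 <= ln 2 :> R.
Proof.
have := @le_ln1Dx R (- 2^-1) ltac:(lra).
rewrite (_ : 1 - 2^-1 = 2^-1); last by lra.
by rewrite lnV ?posrE //; lra.
Qed.

Lemma ln2_gt0 : 0 < ln 2 :> R.
Proof. by have := ln2_ge_half; lra. Qed.

Lemma gauss_measure_itv (l h : R) (b0 b1 : bool) : 0 <= l -> l <= h ->
  gauss_measure [set` Interval (BSide b0 l) (BSide b1 h)] =
  (ln (1 + h) - ln (1 + l)) / ln 2.
Proof.
move=> l0 lh; have L := ln2_gt0.
pose f x := ((1 + x) * ln 2)^-1 : R; pose F x := ln (1 + x) / ln 2 : R.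
have cf x : 0 <= x -> {for x, continuous f}.
  move=> x0; apply: cvgV; first by rewrite gt_eqF // mulr_gt0 //; lra.
  by apply: cvgM; [apply: cvgD; [exact: cvg_cst|exact: cvg_id]|exact: cvg_cst].
have dF x : 0 <= x -> is_derive x 1 F (f x).
  move=> x0; have x1 : 0 < 1 + x by lra.
  have dl := is_derive1_ln x1.
  rewrite /F; apply: is_derive_eq.
  by rewrite /f /= scaler0 !add0r mulr1 invfM mulrC.
have [lh'|hl|->] := ltgtP l h; last 2 first.
- by lra.
- rewrite subrr mul0r /gauss_measure; case: b0; case: b1;
    by rewrite !set_itvE ?Rintegral_set1 ?Rintegral_set0.
have cfI : {within `[l, h], continuous f}.
  apply: continuous_in_subspaceT => x; rewrite inE/= in_itv/= => /andP[lx _].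
  by apply: cf; lra.
have mf : measurable_fun `]l, h[ f.
  apply: (@measurable_funS _ _ _ _ `[l, h]%classic) => //.
    by apply: subset_itv; rewrite bnd_simp.
  exact: subspace_continuous_measurable_fun.
rewrite /gauss_measure /Rintegral integral_itv_bndoo; last exact/measurable_EFinP.
rewrite -(integral_itv_bndoo true false); last exact/measurable_EFinP.
rewrite (@continuous_FTC2 _ f F) //.
- by rewrite /= -mulrBl.
- split=> [x|//|//].
  + by rewrite in_itv/= => /andP[lx _]; have [] := dF x ltac:(lra).
  + apply: cvg_at_right_filter; apply: differentiable_continuous.
    by apply/derivable1_diffP; have [] := dF l l0.
  + apply: cvg_at_left_filter; apply: differentiable_continuous.
    by apply/derivable1_diffP; have [] := dF h ltac:(lra).
- move=> x; rewrite in_itv/= => /andP[lx _]; rewrite derive1E.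
  by have [_ ->] := dF x ltac:(lra).
Qed.

Lemma gauss_measure_cylinder s : posw s -> gauss_measure (cylinder R s) = cyl_prob R s.
Proof.
move=> ps.
have /andP[b10 b11] := @branch01 R s 1 ps (introT andP (conj ler01 (lexx _))).
have /andP[b00 b01] := @branch01 R s 0 ps (introT andP (conj (lexx _) ler01)).
pose l := Num.min (branch s 1) (branch s 0) : R; pose h := Num.max (branch s 1) (branch s 0) : R.
have l0 : 0 <= l by rewrite le_min b10.
have lh : l <= h by rewrite ge_min !le_max !lexx.
(* Which endpoints belong to the cylinder depends on the word, so the bound types are defined by
   membership itself; the measure of the interval is the same for all of them. *)
have -> : cylinder R s = [set` Interval (BSide (l \in cylinder R s) l)
                                        (BSide (h \notin cylinder R s) h)].
  have cyl_closed x : cylinder R s x -> l <= x <= h.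
    move=> /(cylinder_between ps); rewrite /l /h.
    by case: (leP (branch s 1) (branch s 0)) => ? ?; apply/andP; split; nra.
  have open_cyl x : l < x < h -> cylinder R s x.
    move=> /andP[lx xh]; apply: between_cylinder => //; move: lx xh; rewrite /l /h.
    by case: (leP (branch s 1) (branch s 0)) => ? ? ?; nra.
  apply/seteqP; split=> x /=; rewrite itv_boundlr /=.
    move=> xs; have /andP[lx xh] := cyl_closed _ xs; apply/andP; split.
      case: (boolP (l \in _)) => ls; rewrite bnd_simp // lt_neqAle lx andbT.
      by apply: contraNneq ls => ->; exact/mem_set.
    case: (boolP (h \in _)) => hs; rewrite bnd_simp // lt_neqAle xh andbT.
    by apply: contraNneq hs => <-; exact/mem_set.
  move=> /andP[lx xh].
  have [xl|xl] := eqVneq x l.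
    by move: lx; rewrite -xl; case: (boolP (x \in _)) => [/set_mem //|_]; rewrite bnd_simp ltxx.
  have [xh'|xh'] := eqVneq x h.
    by move: xh; rewrite -xh'; case: (boolP (x \in _)) => [/set_mem //|_]; rewrite bnd_simp ltxx.
  apply: open_cyl; rewrite !lt_neqAle xh' eq_sym xl /=.
  move: lx xh; case: (l \in _); case: (h \in _); rewrite !bnd_simp => // *;
    by apply/andP; split=> //; apply/ltW.
rewrite gauss_measure_itv // /cyl_prob; congr (_ / _); rewrite /l /h.
case: (leP (branch s 1) (branch s 0)) => lb.
  by rewrite ler0_norm ?opprB // subr_le0 ler_ln ?posrE; lra.
by rewrite ger0_norm // subr_ge0 ler_ln ?posrE; lra.
Qed.

Lemma ln_dist x y : 0 <= x -> 0 <= y -> `|ln (1 + x) - ln (1 + y)| <= `|x - y|.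
Proof.
wlog xy : x y / x <= y.
  move=> H; case: (leP x y) => [|/ltW] xy x0 y0; first exact: H.
  by rewrite distrC [leRHS]distrC H.
move=> x0 y0; have l : ln (1 + x) <= ln (1 + y) by rewrite ler_ln ?posrE; lra.
rewrite distrC [leRHS]distrC !ger0_norm ?subr_ge0 //.
rewrite -ln_div ?posrE; try lra.
have -> : (1 + y) / (1 + x) = 1 + (y - x) / (1 + x) by field; lra.
have q0 : 0 <= (y - x) / (1 + x) by rewrite divr_ge0; lra.
apply: le_trans (le_ln1Dx _) _; first by lra.
by rewrite ler_pdivrMr; nra.
Qed.

Lemma cyl_prob_ge0 s : 0 <= cyl_prob R s.
Proof. by rewrite divr_ge0 // ltW // ln2_gt0. Qed.

(** The Gauss density is at most 1 / ln 2 <= 2, and [word_prob 0 s] is the length of the cylinder.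
    This carries upper bounds from the Lebesgue chain to word frequencies. *)
Lemma cyl_prob_le_word_prob s : posw s -> cyl_prob R s <= 2 * word_prob (0 : R) s.
Proof.
move=> ps; rewrite /cyl_prob ler_pdivrMr ?ln2_gt0 //.
have /andP[b10 _] := @branch01 R s 1 ps (introT andP (conj ler01 (lexx _))).
have /andP[b00 _] := @branch01 R s 0 ps (introT andP (conj (lexx _) ler01)).
apply: le_trans (ln_dist b10 b00) _; rewrite branch_word_prob //.
have w0 : 0 <= word_prob (0 : R) s by rewrite word_prob_ge0 // lexx ler01.
by have := ln2_ge_half; nra.
Qed.

End CylinderMeasure.

(** * The truncated transition operator and its contraction of monotone functions *)

Definition transition (R : realType) (D : nat) (h : R -> R) (x : R) : R :=
  \sum_(1 <= d < D) digit_prob d x * h (d%:R + x)^-1 + (1 + x) / (D%:R + x) * h 0.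

(* Digits that are at least D are merged into the single symbol D, after which
   the chain restarts at 0; this keeps all sums finite. *)
Fixpoint expect (R : realType) (D n : nat) (x : R) (G : seq nat -> R) : R :=
  if n is n'.+1 then
    \sum_(1 <= d < D) digit_prob d x * expect D n' (d%:R + x)^-1 (fun w => G (d :: w)) +
    (1 + x) / (D%:R + x) * expect D n' 0 (fun w => G (D :: w))
  else G [::].

Section TransitionOperator.
Variables (R : realType) (D : nat).
Hypothesis D_gt0 : (0 < D)%N.
Implicit Types (h g : R -> R) (x y : R).

Local Notation I x := (0 <= (x : R) <= 1).

Let I0 : I 0. Proof. by rewrite lexx ler01. Qed.
Let I1 : I 1. Proof. by rewrite lexx ler01. Qed.

Lemma digit_prob_telescope d x : (0 < d)%N -> 0 <= x ->
  digit_prob d x = (1 + x) / (d%:R + x) - (1 + x) / (d.+1%:R + x).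
Proof.
by move=> /(natr_ge1 R) d1 x0; rewrite /digit_prob -natr1; field; rewrite !gt_eqF //; lra.
Qed.

Lemma sum_digit_prob x : 0 <= x ->
  \sum_(1 <= d < D) digit_prob d x + (1 + x) / (D%:R + x) = 1.
Proof.
case: D D_gt0 => // n _ x0.
elim: n => [|n ih]; first by rewrite big_geq // add0r divff // gt_eqF //; lra.
by rewrite big_nat_recr //= digit_prob_telescope // -[RHS]ih; lra.
Qed.

Lemma tail_ge0 n x : 0 <= x -> 0 <= (1 + x) / (n%:R + x).
Proof. by move=> x0; have n0 : 0 <= n%:R :> R by []; rewrite divr_ge0; lra. Qed.

Lemma avg_le x (F F' : nat -> R) (t t' : R) : 0 <= x ->
  (forall d, (0 < d)%N -> F d <= F' d) -> t <= t' ->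
  \sum_(1 <= d < D) digit_prob d x * F d + (1 + x) / (D%:R + x) * t <=
  \sum_(1 <= d < D) digit_prob d x * F' d + (1 + x) / (D%:R + x) * t'.
Proof.
move=> x0 FF' tt'; apply: lerD; last by rewrite ler_wpM2l // tail_ge0.
rewrite !big_nat; apply: ler_sum => d /andP[d0 _].
by rewrite ler_wpM2l ?digit_prob_ge0 // FF'.
Qed.

Lemma avg_cst x (c : R) : 0 <= x ->
  \sum_(1 <= d < D) digit_prob d x * c + (1 + x) / (D%:R + x) * c = c.
Proof. by move=> x0; rewrite -mulr_suml -mulrDl sum_digit_prob // mul1r. Qed.

Lemma avg_norm_le x (F : nat -> R) (t B : R) : 0 <= x ->
  (forall d, (0 < d)%N -> `|F d| <= B) -> `|t| <= B ->
  `|\sum_(1 <= d < D) digit_prob d x * F d + (1 + x) / (D%:R + x) * t| <= B.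
Proof.
move=> x0 FB tB; rewrite ler_norml; apply/andP; split.
  rewrite -[leLHS](avg_cst _ x0); apply: avg_le => // [d d0|].
    by have := FB _ d0; rewrite ler_norml => /andP[].
  by move: tB; rewrite ler_norml => /andP[].
rewrite -[leRHS](avg_cst _ x0); apply: avg_le => // [d d0|].
  by have := FB _ d0; rewrite ler_norml => /andP[].
by move: tB; rewrite ler_norml => /andP[].
Qed.

Lemma transition_ext h g x : I x -> (forall y, I y -> h y = g y) -> transition D h x = transition D g x.
Proof.
move=> Ix hg; rewrite /transition hg ?I0 //; congr (_ + _).
by rewrite !big_nat; apply: eq_bigr => d /andP[d0 _]; rewrite hg //; exact: inv01.
Qed.

Lemma transitionB h g x : transition D (fun y => h y - g y) x = transition D h x - transition D g x.
Proof.
rewrite /transition mulrBr opprD addrACA -mulrBr mulrBr -sumrB; congr (_ + _).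
by apply: eq_bigr => d _; rewrite mulrBr.
Qed.

Lemma transition_bound h a b x : (forall y, I y -> a <= h y <= b) -> I x ->
  a <= transition D h x <= b.
Proof.
move=> hab /[dup] Ix /andP[x0 _].
have /andP[h0a h0b] := hab _ I0.
by apply/andP; split; [rewrite -[leLHS](avg_cst _ x0)|rewrite -[leRHS](avg_cst _ x0)];
  apply: avg_le => // d d0; have /andP[] := hab _ (inv01 d0 Ix).
Qed.

Definition nondecr01 h := forall x y, 0 <= x -> x <= y -> y <= 1 -> h x <= h y.
Definition nonincr01 h := forall x y, 0 <= x -> x <= y -> y <= 1 -> h y <= h x.

(* Larger ratios make larger digits more likely, and the next ratio 1 / (d + x)
   decreases both in d and in x. *)
Lemma transition_nonincr h : nondecr01 h -> nonincr01 (transition D h).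
Proof.
move=> hm x y x0 xy y1.
have Ix : I x by apply/andP; split; lra.
have Iy : I y by apply/andP; split; lra.
(* Induction on the number of digits kept, with a free value t on the tail. Merging digit n + 1 into
   the tail, with value [hy], gives the induction hypothesis; what remains is that a digit above n +
   1 becomes more likely as the ratio grows ([T]). *)
suff key n (t : R) : ((0 < n)%N -> t <= h (n%:R + y)^-1) ->
    \sum_(1 <= d < n.+1) digit_prob d y * h (d%:R + y)^-1 + (1 + y) / (n.+1%:R + y) * t <=
    \sum_(1 <= d < n.+1) digit_prob d x * h (d%:R + x)^-1 + (1 + x) / (n.+1%:R + x) * t.
  rewrite /transition -(prednK D_gt0); apply: key => n0; apply: hm => //.
    by rewrite invr_ge0 addr_ge0 //; lra.
  by have /andP[] := inv01 n0 Iy.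
elim: n t => [|n ih] t ht.
  by rewrite !big_geq // !add0r !divff ?gt_eqF //; lra.
have n1 : 1 <= n.+1%:R :> R by rewrite natr_ge1.
rewrite [in leLHS]big_nat_recr //= [in leRHS]big_nat_recr //= !digit_prob_telescope //; try lra.
have {}ht := ht isT.
set hy := h (n.+1%:R + y)^-1 in ht *.
have hxy : hy <= h (n.+1%:R + x)^-1.
  apply: hm; first by rewrite invr_ge0; lra.
    by rewrite lef_pV2 ?posrE; lra.
  by have /andP[] := @inv01 R n.+1 x isT Ix.
have /ih {}ih : (0 < n)%N -> hy <= h (n%:R + y)^-1.
  move=> n0; have n2 := natr_ge1 R n0; apply: hm; first by rewrite invr_ge0; lra.
    by rewrite lef_pV2 ?posrE -?natr1; lra.
  by have /andP[] := @inv01 R n y n0 Iy.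
have px : 0 <= (1 + x) / (n.+1%:R + x) - (1 + x) / (n.+2%:R + x).
  by rewrite -digit_prob_telescope // digit_prob_ge0.
have T : (1 + x) / (n.+2%:R + x) <= (1 + y) / (n.+2%:R + y).
  rewrite -[n.+2%:R]natr1 ler_pdivrMr; last by lra.
  by rewrite mulrAC ler_pdivlMr; nra.
have := ler_wpM2l px hxy.
set a := \sum_(_ <= _ < _) _ in ih *; set b := \sum_(_ <= _ < _) _ in ih *.
move: ih T; set s := (1 + y) / _; set s' := (1 + x) / _.
set q := (1 + x) / _; set q' := (1 + y) / _.
move: (h _) => hx; nra.
Qed.

(** Digit d + 1 from ratio 0 and digit d from ratio 1 lead to the same ratio 1 / (d + 1), and the
    second has twice the probability of the first ([EP]). Only digit 1 from ratio 0 stays unmatched;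
    its probability 1/2 is the contraction factor. *)
Lemma transition_halves h : (1 < D)%N -> nondecr01 h ->
  transition D h 0 - transition D h 1 <= (h 1 - h 0) / 2.
Proof.
move=> D1 hm; have h0 y : I y -> h 0 <= h y by move=> /andP[? ?]; apply: hm.
(* The subtracted term belongs to digit n + 1 from ratio 1, not yet matched; it absorbs the gain of
   digit n + 2 from ratio 0 when the level is raised. *)
suff key n : transition n.+2 h 0 - transition n.+2 h 1 <=
    (h 1 - h 0) / 2 - digit_prob n.+1 1 * (h n.+2%:R^-1 - h 0).
  case: D D1 => [|[|n]] // _; apply: le_trans (key n) _.
  rewrite gerBl mulr_ge0 ?digit_prob_ge0 // subr_ge0 h0 //.
  by have := @inv01 R n.+2 0 isT I0; rewrite addr0.
elim: n => [|n ih].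
  rewrite /transition !big_nat1 /digit_prob addr0 invr1 -[2%:R]/(1 + 1 : R).
  set a := h 1; set b := h 0; set c := h (1 + 1)^-1.
  by rewrite le_eqVlt; apply/orP; left; apply/eqP; field.
have UE z : transition n.+3 h z = transition n.+2 h z + (digit_prob n.+2 z * h (n.+2%:R + z)^-1 -
    (1 + z) / (n.+2%:R + z) * h 0 + (1 + z) / (n.+3%:R + z) * h 0).
  by rewrite /transition big_nat_recr //=; lra.
have E0 : (1 + 0) / (n.+2%:R + 0) - (1 + 0) / (n.+3%:R + 0) = digit_prob n.+2 (0 : R).
  by rewrite digit_prob_telescope.
have E1 : (1 + 1) / (n.+2%:R + 1) - (1 + 1) / (n.+3%:R + 1) = digit_prob n.+2 (1 : R).
  by rewrite digit_prob_telescope.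
have EP : digit_prob n.+1 (1 : R) = 2 * digit_prob n.+2 0.
  rewrite /digit_prob !addr0 -!natr1; have n0 : 0 <= n%:R :> R by [].
  by field; rewrite !gt_eqF //; lra.
have b2 : h 0 <= h n.+2%:R^-1.
  by apply: h0; have := @inv01 R n.+2 0 isT I0; rewrite addr0.
have p2 := @digit_prob_ge0 R n.+2 0 (lexx _).
rewrite !addr0 in E0.
rewrite [n.+2%:R + 1]natr1 in E1.
rewrite EP in ih.
rewrite !UE !addr0 [n.+2%:R + 1]natr1.
have := congr1 (fun z => z * h 0) E0; have := congr1 (fun z => z * h 0) E1.
have := ler_wpM2l p2 b2.
move: ih; move: (transition _ _ _) (transition _ _ _) (digit_prob _ _) (digit_prob _ _) (h _) (h _) (h 1) (h 0).
move: (1 / _) (1 / _) ((1 + 1) / _) ((1 + 1) / _) => *; lra.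
Qed.

(** Both directions are allowed because [transition] exchanges them; for a monotone function the
    endpoint difference is the whole oscillation. *)
Definition mono_osc (e : R) h :=
  (nondecr01 h \/ nonincr01 h) /\ `|h 1 - h 0| <= e.

Lemma transition_mono_osc e h : (1 < D)%N -> mono_osc e h -> mono_osc (e / 2) (transition D h).
Proof.
have N g x : transition D (fun y => - g y) x = - transition D g x.
  rewrite /transition mulrN opprD -sumrN; congr (_ + _).
  by apply: eq_bigr => d _; rewrite mulrN.
move=> D1 [[hm|hm] he]; split.
- by right; apply: transition_nonincr.
- have le0 : transition D h 1 <= transition D h 0 by apply: transition_nonincr.
  rewrite ler0_norm ?subr_le0 // opprB; apply: le_trans (transition_halves D1 hm) _.
  by move: he; rewrite ler_norml => /andP[_]; lra.
- left=> x y x0 xy y1; have := @transition_nonincr (fun y => - h y) _ x y x0 xy y1.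
  by rewrite !N lerN2; apply=> u v u0 uv v1; rewrite lerN2 hm.
- have hm' : nondecr01 (fun y => - h y) by move=> u v u0 uv v1; rewrite lerN2 hm.
  have := transition_nonincr hm' (lexx _) ler01 (lexx _); rewrite !N lerN2 => le0.
  have := transition_halves D1 hm'; rewrite !N => H.
  rewrite ger0_norm ?subr_ge0 //.
  by move: he; rewrite ler_norml => /andP[+ _]; lra.
Qed.

Lemma mono_osc_dist e h x y : mono_osc e h -> I x -> I y -> `|h x - h y| <= e.
Proof.
move=> [hm] /[swap] /andP[x0 x1] /[swap] /andP[y0 y1].
rewrite !ler_norml => /andP[e1 e2].
case: hm => hm; have := hm 0 x (lexx _) x0 x1; have := hm x 1 x0 x1 (lexx _);
  have := hm 0 y (lexx _) y0 y1; have := hm y 1 y0 y1 (lexx _);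
  have := hm 0 1 (lexx _) ler01 (lexx _); lra.
Qed.

Lemma iter_transition_mono_osc e h n : (1 < D)%N -> mono_osc e h ->
  mono_osc (e * 2^-1 ^+ n) (iter n (transition D) h).
Proof.
move=> D1 he; elim: n => [|n ih]; first by rewrite expr0 mulr1.
by rewrite iterS exprSr mulrA; apply: transition_mono_osc.
Qed.

Lemma iter_transition_bound h a b n x : (forall y, I y -> a <= h y <= b) -> I x ->
  a <= iter n (transition D) h x <= b.
Proof. by move=> hab; elim: n x => // n ih x Ix; apply: transition_bound. Qed.

Lemma iter_transitionB h g n x : I x ->
  iter n (transition D) (fun y => h y - g y) x = iter n (transition D) h x - iter n (transition D) g x.
Proof. by elim: n x => // n ih x Ix; rewrite !iterS (transition_ext Ix ih) transitionB. Qed.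

(** The N-th iterate averages values of the n-th one, whose oscillation is at most e / 2^n. A
    difference of monotone functions need not be monotone, so h and g are treated separately, whence
    the factor 2. *)
Lemma iter_transition_dist h g e n N x y : (1 < D)%N -> mono_osc e h -> mono_osc e g ->
  I x -> I y -> (n <= N)%N ->
  `|iter n (transition D) (fun z => h z - g z) x - iter N (transition D) (fun z => h z - g z) y| <=
  2 * e * 2^-1 ^+ n.
Proof.
move=> D1 he ge Ix Iy nN.
have key k : mono_osc e k ->
    `|iter n (transition D) k x - iter N (transition D) k y| <= e * 2^-1 ^+ n.
  move=> /(iter_transition_mono_osc n D1) kn; set k' := iter n (transition D) k in kn *.
  have : k' x - e * 2^-1 ^+ n <= iter N (transition D) k y <= k' x + e * 2^-1 ^+ n.
    rewrite -(subnK nN) iterD -/k'; apply: iter_transition_bound => // z Iz.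
    have := mono_osc_dist kn Ix Iz; rewrite ler_norml => /andP[].
    by move: (e * _) => q *; apply/andP; split; lra.
  by rewrite ler_norml => /andP[]; move: (e * _) => q *; apply/andP; split; lra.
rewrite !iter_transitionB // [X in `|X|](_ : _ = (iter n (transition D) h x - iter N (transition D) h y) -
  (iter n (transition D) g x - iter N (transition D) g y)); last by lra.
apply: le_trans (ler_normB _ _) _; have := key _ he; have := key _ ge.
by rewrite -mulrA; move: (e * _) => q; lra.
Qed.

End TransitionOperator.

(** * Expectations of functions of the digits produced by the chain *)

Section Expectation.
Variables (R : realType) (D : nat).
Hypothesis D_gt0 : (0 < D)%N.
Implicit Types (x y : R) (G H : seq nat -> R).

Local Notation I x := (0 <= (x : R) <= 1).

Let I0 : I 0. Proof. by rewrite lexx ler01. Qed.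

Lemma expect_le n x G H : I x -> (forall w, G w <= H w) -> expect D n x G <= expect D n x H.
Proof.
elim: n x G H => [|n ih] x G H Ix GH /=; first exact: GH.
apply: avg_le; first by case/andP: Ix.
  by move=> d d0; apply: ih => [|w]; [exact: inv01|exact: GH].
by apply: ih.
Qed.

Lemma expect_cst n x (c : R) : I x -> expect D n x (fun=> c) = c.
Proof.
elim: n x => // n ih x /[dup] Ix /andP[x0 _] /=.
rewrite ih // -[RHS](avg_cst D_gt0 c x0); congr (_ + _).
by rewrite !big_nat; apply: eq_bigr => d /andP[d0 _]; rewrite ih // inv01.
Qed.

Lemma expect_lin n x (a b : R) G H :
  expect D n x (fun w => a * G w + b * H w) = a * expect D n x G + b * expect D n x H.
Proof.
elim: n x G H => // n ih x G H /=; rewrite ih.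
under eq_bigr => d _ do rewrite ih mulrDr (mulrCA _ a) (mulrCA _ b).
by rewrite big_split /= -!mulr_sumr; lra.
Qed.

Lemma expect_D n x G H : expect D n x (fun w => G w + H w) = expect D n x G + expect D n x H.
Proof.
have := expect_lin n x 1 1 G H; rewrite !mul1r => <-.
by congr (expect _ _ _ _); apply/funext => w; rewrite !mul1r.
Qed.

Lemma expect_Z n x (a : R) G : expect D n x (fun w => a * G w) = a * expect D n x G.
Proof.
have := expect_lin n x a 0 G G; rewrite mul0r addr0 => <-.
by congr (expect _ _ _ _); apply/funext => w; rewrite mul0r addr0.
Qed.

Lemma expect_sum n x L (F : nat -> seq nat -> R) : I x ->
  expect D n x (fun w => \sum_(l < L) F l w) = \sum_(l < L) expect D n x (F l).
Proof.
move=> Ix; elim: L => [|L ih].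
  under [X in expect _ _ _ X]eq_fun do rewrite big_ord0.
  by rewrite expect_cst // big_ord0.
under [X in expect _ _ _ X]eq_fun do rewrite big_ord_recr /=.
by rewrite expect_D ih big_ord_recr.
Qed.

Lemma expect_norm_le n x G (B : R) : I x -> (forall w, `|G w| <= B) -> `|expect D n x G| <= B.
Proof.
move=> Ix GB; rewrite ler_norml.
by apply/andP; split; [rewrite -[leLHS](expect_cst n _ Ix)|rewrite -[leRHS](expect_cst n _ Ix)];
  apply: expect_le => // w; have := GB w; rewrite ler_norml => /andP[].
Qed.

Lemma expect_behead n x H (C : R) : I x -> (forall y, I y -> expect D n y H <= C) ->
  expect D n.+1 x (fun w => H (behead w)) <= C.
Proof.
move=> /[dup] Ix /andP[x0 _] HC /=; rewrite -[leRHS](avg_cst D_gt0 C x0).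
by apply: avg_le => // [d d0|]; apply: HC => //; apply: inv01.
Qed.

(** Markov property: after r digits the chain continues from some ratio in [0, 1], and the bound B
    is uniform in that ratio. *)
Lemma expect_cov n r x G H (B : R) : I x -> (forall w, `|G w| <= 1) ->
  (forall y, I y -> `|expect D n y H| <= B) ->
  `|expect D (r + n) x (fun w => G (take r w) * H (drop r w))| <= B.
Proof.
elim: r x G => [|r ih] x G Ix G1 HB.
  rewrite (_ : (fun w => _) = fun w => G [::] * H w); last first.
    by apply/funext => w; rewrite take0 drop0.
  rewrite expect_Z normrM -[leRHS]mul1r ler_pM //.
  exact: HB.
rewrite addSn /=; apply: avg_norm_le => //; first by case/andP: Ix.
  by move=> d d0; apply: (ih _ (fun w => G (d :: w))) => //; apply: inv01.
by apply: (ih _ (fun w => G (D :: w))).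
Qed.

End Expectation.

(** * Correlations and variance of block sums *)

Definition ones (R : realType) (m l : nat) (w : seq nat) : R :=
  ((nth 0%N w l == 1%N) && (nth 0%N w (l + m)%N == 1%N))%:R.

Section Variance.
Variables (R : realType) (D m : nat).
Hypotheses (D_gt1 : (1 < D)%N) (m_gt0 : (0 < m)%N).
Implicit Types (x y : R).

Local Notation I x := (0 <= (x : R) <= 1).
Local Notation f := (ones R m).

Let D_gt0 : (0 < D)%N. Proof. exact: ltnW. Qed.
Let I0 : I 0. Proof. by rewrite lexx ler01. Qed.

Lemma expect_digit_one j n y : I y -> (j < n)%N ->
  expect D n y (fun w => (nth 0%N w j == 1%N)%:R) = iter j (transition D) (@digit_prob R 1) y.
Proof.
elim: j n y => [|j ih] [|n] // y /[dup] Iy /andP[y0 _] jn /=.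
  rewrite big_ltn // big_nat big1 => [|d /andP[d1 _]]; last first.
    by rewrite expect_cst ?inv01 //; [rewrite gtn_eqF //= mulr0n mulr0|exact: ltnW].
  by rewrite !expect_cst ?(@inv01 R 1%N) // (gtn_eqF D_gt1) /= mulr0n !mulr0 !addr0 mulr1.
rewrite -(transition_ext D Iy (fun z Iz => ih n z Iz jn)).
by [].
Qed.

(** A digit 1 moves the ratio to 1 / (1 + y); the next m - 1 digits are free, one application of
    [transition] each, and then comes another 1. *)
Definition one_gap_prob y : R := digit_prob 1 y * iter m.-1 (transition D) (@digit_prob R 1) (1 + y)^-1.

Lemma expect_ones l n y : I y -> (l + m < n)%N -> expect D n y (f l) = iter l (transition D) one_gap_prob y.
Proof.
elim: l n y => [|l ih] [|n] // y /[dup] Iy /andP[y0 _] ln; last first.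
  by rewrite iterS -(transition_ext D Iy (fun z Iz => ih n z Iz ln)).
rewrite /= big_ltn // big_nat big1 => [|d /andP[d1 _]]; last first.
  rewrite (_ : (fun w => _) = fun=> 0) ?expect_cst ?inv01 ?mulr0 //; first exact: ltnW.
  by apply/funext => w; rewrite /ones /= gtn_eqF.
rewrite (_ : (fun w => f 0 (D :: w)) = fun=> 0) ?expect_cst ?mulr0 ?addr0 //; last first.
  by apply/funext => w; rewrite /ones /= gtn_eqF.
rewrite /one_gap_prob -(@expect_digit_one _ n); last 2 first.
- exact: (@inv01 R 1%N).
- by move: ln; rewrite add0n; lia.
by rewrite ?addr0; congr (_ * expect _ _ _ _); apply/funext => w; rewrite /ones -[in LHS](prednK m_gt0).
Qed.

Lemma digit_prob_one_nonincr : nonincr01 (@digit_prob R 1).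
Proof.
move=> x y x0 xy y1.
have PE z : 0 <= z -> digit_prob 1 z = (2 + z)^-1 :> R.
  by move=> z0; rewrite /digit_prob; field; rewrite !gt_eqF //; lra.
by rewrite !PE ?lef_pV2 ?posrE; lra.
Qed.

Lemma digit_prob_one_01 y : I y -> 0 <= digit_prob 1 y <= 1.
Proof.
move=> /[dup] Iy /andP[y0 _]; rewrite digit_prob_ge0 //=.
by apply: le_trans (digit_prob_le_half _ Iy) _ => //; lra.
Qed.

(* A product of two monotone functions with values in [0, 1] is a difference of
   two monotone ones: if u decreases and v increases, u v = v - (1 - u) v. *)
Lemma one_gap_prob_mono : exists h g : R -> R, [/\ mono_osc 1 h, mono_osc 1 g &
  one_gap_prob = (fun z => h z - g z)].
Proof.
pose k : R -> R := iter m.-1 (transition D) (@digit_prob R 1).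
have k01 z : I z -> 0 <= k z <= 1 by move=> Iz; apply: iter_transition_bound Iz => // ?; exact: digit_prob_one_01.
have Iv z : I z -> I (1 + z)^-1 by exact: (@inv01 R 1%N).
have vm (z t : R) : 0 <= z -> z <= t -> (1 + t)^-1 <= (1 + z)^-1.
  by move=> z0 zt; rewrite lef_pV2 ?posrE; lra.
have osc (h : R -> R) : (forall z, I z -> 0 <= h z <= 1) -> `|h 1 - h 0| <= 1.
  move=> h01; have /andP[? ?] := h01 0 I0.
  have /andP[? ?] := h01 1 ltac:(by rewrite lexx ler01).
  by rewrite ler_norml; apply/andP; split; lra.
have [|[k_nd|k_ni] _] := @iter_transition_mono_osc R D D_gt0 1 (@digit_prob R 1) m.-1 D_gt1.
- by split; [right; exact: digit_prob_one_nonincr|apply: osc => ?; exact: digit_prob_one_01].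
- exists one_gap_prob, (fun=> 0); split; last by apply/funext => z; rewrite subr0.
    split; last first.
      apply: osc => z Iz.
      have /andP[? ?] := digit_prob_one_01 Iz; have /andP[? ?] := k01 _ (Iv _ Iz).
      by rewrite /one_gap_prob -/k; apply/andP; split; nra.
    right=> z t z0 zt t1.
    have Iz : I z by apply/andP; split; lra.
    have It : I t by apply/andP; split; lra.
    have /andP[? ?] := digit_prob_one_01 Iz; have /andP[? ?] := digit_prob_one_01 It.
    have /andP[? ?] := k01 _ (Iv _ Iz); have /andP[? ?] := k01 _ (Iv _ It).
    have /andP[? ?] := Iv _ It; have /andP[? ?] := Iv _ Iz.
    rewrite /one_gap_prob -/k; apply: ler_pM => //; first exact: digit_prob_one_nonincr.
    by apply: k_nd => //; exact: vm.
  by split; [left|rewrite subrr normr0].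
- pose v z := k (1 + z)^-1.
  have v_nd : nondecr01 v.
    move=> z t z0 zt t1.
    have /andP[? ?] := Iv z ltac:(apply/andP; split; lra).
    have /andP[? ?] := Iv t ltac:(apply/andP; split; lra).
    by apply: k_ni => //; exact: vm.
  exists v, (fun z => (1 - digit_prob 1 z) * v z); split.
  + by split; [left|apply: osc => z Iz; exact: k01 (Iv _ Iz)].
  + split; last first.
      apply: (osc (fun z => (1 - digit_prob 1 z) * v z)) => z Iz.
      have /andP[? ?] := digit_prob_one_01 Iz; have /andP[? ?] := k01 _ (Iv _ Iz).
      by rewrite /v; apply/andP; split; nra.
    left=> z t z0 zt t1.
    have Iz : I z by apply/andP; split; lra.
    have /andP[? ?] := digit_prob_one_01 Iz; have /andP[? ?] := k01 _ (Iv _ Iz).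
    by apply: ler_pM => //; [lra|rewrite lerB // digit_prob_one_nonincr|exact: v_nd].
  + by apply/funext => z; rewrite /one_gap_prob -/k -/(v z); lra.
Qed.

Lemma iter_transition_one_gap_dist n N x y : I x -> I y -> (n <= N)%N ->
  `|iter n (transition D) one_gap_prob x - iter N (transition D) one_gap_prob y| <= 2 * 2^-1 ^+ n.
Proof.
move=> Ix Iy nN; have [h [g [hm gm ->]]] := one_gap_prob_mono.
by have := iter_transition_dist D_gt0 D_gt1 hm gm Ix Iy nN; rewrite mulr1.
Qed.

Lemma iter_transition_one_gap_01 N : 0 <= iter N (transition D) one_gap_prob 0 <= 1.
Proof.
apply: (iter_transition_bound D_gt0) => // y Iy; have /andP[? ?] := digit_prob_one_01 Iy.
rewrite /one_gap_prob; set z := (1 + y)^-1.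
have /andP[? ?] : 0 <= iter m.-1 (transition D) (@digit_prob R 1) z <= 1.
  by apply: (iter_transition_bound D_gt0) => //; [exact: digit_prob_one_01|exact: (@inv01 R 1%N)].
by apply/andP; split; nra.
Qed.

Variable N : nat.
(** Stands in for the stationary mean: for l <= N the expectation at position l is within 2 / 2^l of
    it, from every starting ratio. *)
Let c : R := iter N (transition D) one_gap_prob 0.

Let c01 : I c. Proof. exact: iter_transition_one_gap_01. Qed.

Let fc_le1 l w : `|f l w - c| <= 1.
Proof.
have /andP[? ?] := c01; rewrite /ones ler_norml.
by case: ((nth _ _ _ == _) && _) => /=; apply/andP; split; lra.
Qed.

(** For l <= m the trivial bound 1 is enough. For l > m the first factor reads only the first m + 1
    digits, and conditionally on these the second has mean at most 2 / 2^(l - m - 1) = 2^(m + 2) /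
    2^l in absolute value. *)
Lemma expect_ones_cov l n x : I x -> (l <= N)%N -> (l + m < n)%N ->
  `|expect D n x (fun w => (f 0 w - c) * (f l w - c))| <= 2 ^+ m.+2 * 2^-1 ^+ l.
Proof.
move=> Ix lN ln; have [lm|ml] := leqP l m.
  apply: (@le_trans _ _ 1).
    by apply: expect_norm_le => // w; rewrite normrM -[leRHS]mul1r ler_pM.
  rewrite exprVn ler_pdivlMr ?exprn_gt0 // mul1r ler_weXn2l ?ler1n //; lia.
have -> : n = (m.+1 + (n - m.+1))%N by lia.
rewrite (_ : (fun w => _) =
  (fun w => (f 0 (take m.+1 w) - c) * (f (l - m.+1) (drop m.+1 w) - c))); last first.
  apply/funext => w; rewrite /ones add0n !nth_take // !nth_drop.
  by rewrite addnA (subnKC ml).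
apply: le_trans (@expect_cov _ _ D_gt0 _ _ _ (fun w => f 0 w - c)
  (fun w => f (l - m.+1) w - c) (2 * 2^-1 ^+ (l - m.+1)) _ _ _) _ => //.
  move=> y Iy; rewrite expect_D expect_cst // expect_ones //; last by lia.
  by apply: iter_transition_one_gap_dist => //; lia.
rewrite -[X in _ <= _ * _ ^+ X](subnKC ml) exprD [2 ^+ m.+2]exprS mulrA -(mulrA 2).
by rewrite -exprMn mulfV // expr1n mulr1.
Qed.

Lemma sum_half L : \sum_(l < L) 2^-1 ^+ l.+1 <= 1 :> R.
Proof.
suff -> : \sum_(l < L) 2^-1 ^+ l.+1 = 1 - 2^-1 ^+ L :> R by rewrite gerBl exprn_ge0.
elim: L => [|L ih]; first by rewrite big_ord0 expr0 subrr.
by rewrite big_ord_recr /= ih exprS; lra.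
Qed.

(** Induction on L by splitting off the first position: its square costs K^2, its cross terms with
    the later positions sum geometrically to at most 2 K^2 2^(m + 2), and the rest is the same
    problem with shifted weights and another starting ratio. *)
Lemma variance_ones (K : R) L x (chi : nat -> R) : I x -> (L <= N.+1)%N ->
  (forall l, `|chi l| <= K) ->
  expect D (L + m) x (fun w => (\sum_(l < L) chi l * (f l w - c)) ^+ 2) <=
  K ^+ 2 * (1 + 2 * 2 ^+ m.+2) * L%:R.
Proof.
move=> + + chiK; have K0 : 0 <= K by apply: le_trans (chiK 0%N).
elim: L x chi chiK => [|L ih] x chi chiK Ix LN.
  by rewrite mulr0 (_ : (fun w => _) = fun=> 0) ?expect_cst // ;
     apply/funext => w; rewrite big_ord0 expr0n.
pose S w := \sum_(l < L) chi l.+1 * (f l w - c).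
rewrite (_ : (fun w => _) = (fun w => chi 0%N ^+ 2 * (f 0 w - c) ^+ 2 +
   2 * chi 0%N * (\sum_(l < L) chi l.+1 * ((f 0 w - c) * (f l.+1 w - c))) +
   S (behead w) ^+ 2)); last first.
  apply/funext => w; rewrite big_ord_recl.
  have -> : \sum_(i < L) chi (lift ord0 i) * (f (lift ord0 i) w - c) = S (behead w).
    by apply: eq_bigr => l _; rewrite /ones !nth_behead.
  have -> : \sum_(l < L) chi l.+1 * ((f 0 w - c) * (f l.+1 w - c)) =
      (f 0 w - c) * S (behead w).
    rewrite /S mulr_sumr; apply: eq_bigr => l _; rewrite mulrCA.
    by rewrite /ones !nth_behead.
  by rewrite /=; ring.
rewrite !expect_D expect_Z [X in _ + X + _]expect_Z.
rewrite (expect_sum D_gt0 _ _ (fun l w => chi l.+1 * ((f 0 w - c) * (f l.+1 w - c)))) //.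
have e1 : chi 0%N ^+ 2 * expect D (L.+1 + m) x (fun w => (f 0 w - c) ^+ 2) <= K ^+ 2.
  rewrite -[leRHS]mulr1; apply: ler_pM; first exact: sqr_ge0.
  - by rewrite -(expect_cst D_gt0 (L.+1 + m) 0 Ix); apply: expect_le => // w; exact: sqr_ge0.
  - by rewrite -real_normK ?num_real // ler_pXn2r ?nnegrE.
  - rewrite -[leRHS](expect_cst D_gt0 (L.+1 + m) 1 Ix); apply: expect_le => // w.
    by rewrite -real_normK ?num_real // expr_le1.
have e3 : expect D (L.+1 + m) x (fun w => S (behead w) ^+ 2) <=
    K ^+ 2 * (1 + 2 * 2 ^+ m.+2) * L%:R.
  apply: (@expect_behead _ _ D_gt0 (L + m) _ (fun w => S w ^+ 2)) => // y Iy.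
  by apply: (ih y (fun l => chi l.+1)) => //; exact: ltnW.
have e2 : 2 * chi 0%N * \sum_(l < L) expect D (L.+1 + m) x
    (fun w => chi l.+1 * ((f 0 w - c) * (f l.+1 w - c))) <=
    K ^+ 2 * (2 * 2 ^+ m.+2).
  apply: le_trans (ler_norm _) _; rewrite !normrM ger0_norm // expr2.
  rewrite [leRHS](_ : _ = 2 * K * (K * 2 ^+ m.+2)); last by ring.
  apply: ler_pM => //; first by rewrite ler_wpM2l.
  apply: le_trans (ler_norm_sum _ _ _) _.
  apply: (@le_trans _ _ (\sum_(l < L) K * 2 ^+ m.+2 * 2^-1 ^+ l.+1)).
    apply: ler_sum => l _; rewrite expect_Z normrM -mulrA; apply: ler_pM => //.
    have lL := ltn_ord l; apply: expect_ones_cov => //; lia.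
  rewrite -mulr_sumr -[leRHS]mulr1 ler_wpM2l ?sum_half // mulr_ge0 ?exprn_ge0 //.
apply: le_trans (lerD (lerD e1 e2) e3) _.
by rewrite -[L.+1%:R]natr1; move: (2 ^+ _) (L%:R) => A l; lra.
Qed.

End Variance.

(** * Lower bound for a digit 1 in second place after an arbitrary word *)

Section PairWithOne.
Variable R : realType.
Implicit Types (x y z u : R) (s v : seq nat) (d : nat).

Local Notation I x := (0 <= (x : R) <= 1).

Lemma nondecr01_deriv (F f : R -> R) :
  (forall x, I x -> is_derive x 1 F (f x)) -> (forall x, I x -> 0 <= f x) ->
  nondecr01 F.
Proof.
move=> dF f0 x y x0 xy y1.
have Iz z : z \in `[x, y]%R -> I z.
  by rewrite in_itv /= => /andP[? ?]; apply/andP; split; lra.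
have [z zxy] : exists2 c, c \in `[x, y]%R & F y - F x = f c * (y - x).
  apply: MVT_segment => // [z zxy|].
    by apply: dF; apply: Iz; apply: subset_itv_oo_cc zxy.
  apply: derivable_within_continuous => z zxy.
  by have [] := dF _ (Iz _ zxy).
move=> E; rewrite -subr_ge0 E mulr_ge0 ?subr_ge0 // f0 //; exact: Iz.
Qed.

Lemma is_derive_lnD (a x : R) : 0 < a + x ->
  is_derive x 1 (fun u => ln (a + u) : R) (a + x)^-1.
Proof.
move=> ax; have dl := is_derive1_ln ax.
by apply: is_derive_eq; rewrite /= add0r mulr1.
Qed.

(** With s = t + u the derivative has the sign of (s + 1/3)(s + 4/3) - (s + 1/2)(s + 1) = s/6 -
    1/18. The arguments t + 1/3 and t + 4/3 differ by 1, so the subtracted terms for consecutive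
    integers t cancel. *)
Lemma telescoping_step t : 1 <= t -> nondecr01 (fun u : R =>
  2 * (ln (t + 2^-1 + u) - ln (t + 1 + u)) -
  (ln (t + 3^-1 + u) - ln (t + 4 / 3 + u))).
Proof.
move=> t1.
pose f u : R := 2 * ((t + 2^-1 + u)^-1 - (t + 1 + u)^-1) -
  ((t + 3^-1 + u)^-1 - (t + 4 / 3 + u)^-1).
apply: (@nondecr01_deriv _ f) => x /andP[x0 x1].
  have d1 := @is_derive_lnD (t + 2^-1) x ltac:(lra).
  have d2 := @is_derive_lnD (t + 1) x ltac:(lra).
  have d3 := @is_derive_lnD (t + 3^-1) x ltac:(lra).
  have d4 := @is_derive_lnD (t + 4 / 3) x ltac:(lra).
  by apply: is_derive_eq.
rewrite /f [leRHS](_ : _ =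
  ((t + x) / 6 - 18^-1) / ((t + 2^-1 + x) * (t + 1 + x) * (t + 3^-1 + x) * (t + 4 / 3 + x))).
  by rewrite divr_ge0 ?mulr_ge0; lra.
by field; rewrite !gt_eqF //; lra.
Qed.

(** 3/4 is the minimum over [0, 1] of the quotient (1 + u) / (4/3 + u) of the derivatives, attained
    at u = 0. Half of it is the constant 3/8. *)
Lemma telescoping_first : nondecr01 (fun u : R => ln (4 / 3 + u) - 3 / 4 * ln (1 + u)).
Proof.
apply: (@nondecr01_deriv _ (fun u => (4 / 3 + u)^-1 - 3 / 4 * (1 + u)^-1)) => x /andP[x0 x1].
  have d1 := @is_derive_lnD (4 / 3) x ltac:(lra).
  have d2 := @is_derive_lnD 1 x ltac:(lra).
  by apply: is_derive_eq.
rewrite [leRHS](_ : _ = x / 4 / ((4 / 3 + x) * (1 + x))).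
  by rewrite divr_ge0 ?mulr_ge0; lra.
by field; rewrite !gt_eqF //; lra.
Qed.

Lemma ln_quot_le (x y : R) : 0 < x -> x <= y -> ln y - ln x <= (y - x) / x.
Proof.
move=> x0 xy; rewrite -ln_div ?posrE; try lra.
have -> : y / x = 1 + (y - x) / x by field; lra.
have q0 : 0 <= (y - x) / x by rewrite divr_ge0; lra.
by apply: le_ln1Dx; lra.
Qed.

Lemma ln_quot_ge (x y : R) : 0 < x -> x <= y -> (y - x) / y <= ln y - ln x.
Proof.
move=> x0 xy; rewrite -[leRHS]opprB lerNr -ln_div ?posrE; try lra.
have -> : x / y = 1 + - ((y - x) / y) by field; lra.
have xy0 : 0 < x / y by rewrite divr_gt0; lra.
have q : (y - x) / y = 1 - x / y by field; lra.
by apply: le_ln1Dx; lra.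
Qed.

(** Up to an additive constant this is ln (1 + [branch v y]), with be = (p' + q') / (p + q) and al =
    q' / q for the coefficients of [branch_mobius]. Hence its increments, divided by ln 2, are
    signed Gauss measures of cylinders that extend v. *)
Definition mobius_log (al be y : R) : R := ln (1 + be * y) - ln (1 + al * y).

Lemma mobius_log_inv al be t : I al -> I be -> 0 < t ->
  mobius_log al be t^-1 = ln (t + be) - ln (t + al).
Proof.
move=> /andP[a0 a1] /andP[b0 b1] t0.
have E u : 0 <= u -> ln (1 + u * t^-1) = ln (t + u) - ln t.
  by move=> u0; rewrite -ln_div ?posrE; [congr ln; field; lra|lra|lra].
by rewrite /mobius_log !E //; lra.
Qed.

(* The comparison 1/((t+1/2)(t+1)) >= 1/((t+1/3)(t+4/3)) makes the sum telescope. *)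
Lemma mobius_log_sum_ge (D : nat) al be : (0 < D)%N -> 0 <= al -> al <= be -> be <= 1 ->
  (3 / 8 - D%:R^-1) * (mobius_log al be 1 - mobius_log al be 0) <=
  \sum_(1 <= d < D) (mobius_log al be (d%:R + 2^-1)^-1 - mobius_log al be (d%:R + 1)^-1).
Proof.
move=> D0 a0 ab b1.
have Ia : I al by apply/andP; split; lra.
have Ib : I be by apply/andP; split; lra.
pose psi (t : R) := ln (t + 3^-1 + be) - ln (t + 3^-1 + al).
have tel : psi 1 - psi D%:R <=
    2 * \sum_(1 <= d < D) (mobius_log al be (d%:R + 2^-1)^-1 - mobius_log al be (d%:R + 1)^-1).
  case: D D0 => // n _; elim: n => [|n ih]; first by rewrite big_geq // mulr0 subrr.
  rewrite big_nat_recr //= mulrDr.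
  have n1 : 1 <= n.+1%:R :> R by rewrite natr_ge1.
  rewrite !mobius_log_inv //; try lra.
  have := telescoping_step n1 a0 ab b1.
  rewrite (_ : n.+1%:R + 4 / 3 = n.+2%:R + 3^-1) /=; last by rewrite -[n.+2%:R]natr1; lra.
  move: ih; rewrite /psi; lra.
have f1 := telescoping_first a0 ab b1.
have psi1 : psi 1 = ln (4 / 3 + be) - ln (4 / 3 + al).
  by rewrite /psi (_ : 1 + 3^-1 = 4 / 3) //; lra.
have d1 := natr_ge1 R D0.
have T : mobius_log al be 1 - mobius_log al be 0 = ln (1 + be) - ln (1 + al).
  by rewrite /mobius_log !mulr0 !mulr1 !addr0 subrr subr0.
(* Cutting the sum at D loses half of [psi D], at most (be - al) / (2 D); this bound turns the loss
   into 1 / D times the total increment. *)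
have Tge : (be - al) / 2 <= ln (1 + be) - ln (1 + al).
  apply: le_trans (@ln_quot_ge (1 + al) (1 + be) _ _); try lra.
  rewrite (_ : 1 + be - (1 + al) = be - al); last by lra.
  by rewrite ler_wpM2l ?subr_ge0 // lef_pV2 ?posrE; lra.
have psiD : psi D%:R <= (be - al) * D%:R^-1.
  apply: le_trans (@ln_quot_le _ _ _ _) _; try lra.
  rewrite (_ : _ - _ = be - al); last by lra.
  by rewrite ler_wpM2l ?subr_ge0 // lef_pV2 ?posrE; lra.
have DV : 0 <= D%:R^-1 :> R by rewrite invr_ge0.
have := ler_wpM2r DV Tge.
rewrite T; move: tel psiD psi1 f1; move: (\sum_(_ <= _ < _) _) (D%:R^-1) DV => S q q0.
move: (psi _) (psi _) => p1 p2; move: (ln _) (ln _) (ln _) (ln _) => l1 l2 l3 l4 /=; lra.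
Qed.

(** The coefficients are numerators and denominators of the last two convergents. The inequalities
    q' <= q and p' + q' <= p + q place the two parameters of [mobius_log] in [0, 1]. *)
Lemma branch_mobius v : posw v -> exists p p' q q' : R,
  [/\ 0 <= p /\ 0 <= p', 0 < q /\ 0 <= q', q' <= q /\ p' + q' <= p + q &
      forall y, I y -> branch v y = (p + p' * y) / (q + q' * y)].
Proof.
elim: v => [_|d v ih /= /andP[d0 /ih [p [p' [q [q' [[? ?] [? ?] [? ?] E]]]]]]].
  exists 0, 1, 1, 0; split; try by split; lra.
  by move=> y _; rewrite /= mul0r addr0 add0r mul1r divr1.
have d1 := natr_ge1 R d0.
have dq : 1 * q <= d%:R * q by rewrite ler_pM2r.
have dq' : 0 <= d%:R * q' by rewrite mulr_ge0.
have dqq : 0 <= (d%:R - 1) * (q - q') by rewrite mulr_ge0; lra.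
exists q, q', (d%:R * q + p), (d%:R * q' + p'); split; try by split; lra.
move=> y /[dup] Iy /andP[y0 y1]; rewrite /= E //.
have py : 0 <= p' * y by rewrite mulr_ge0.
have qy : 0 <= q' * y by rewrite mulr_ge0.
have dqy : 0 <= d%:R * (q' * y) by rewrite mulr_ge0.
have n1 : q + q' * y != 0 by rewrite gt_eqF //; lra.
have n2 : d%:R * (q + q' * y) + (p + p' * y) != 0 by rewrite gt_eqF //; lra.
have n3 : d%:R * q + p + (d%:R * q' + p') * y != 0 by rewrite gt_eqF //; lra.
have -> : d%:R + (p + p' * y) / (q + q' * y) =
    (d%:R * (q + q' * y) + (p + p' * y)) / (q + q' * y).
  by rewrite [RHS]mulrDl mulfK.
rewrite invf_div; congr (_ / _); ring.
Qed.

Lemma ln_branch_mobius_log v : posw v -> exists al be : R, [/\ I al, I be &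
  forall y z, I y -> I z ->
    ln (1 + branch v y) - ln (1 + branch v z) = mobius_log al be y - mobius_log al be z].
Proof.
move=> /branch_mobius [p [p' [q [q' [[p0 p0'] [q0 q0'] [qq pq] E]]]]].
exists (q' / q), ((p' + q') / (p + q)); split.
- by rewrite divr_ge0 ?ler_pdivrMr ?mul1r; lra.
- by rewrite divr_ge0 ?ler_pdivrMr ?mul1r; lra.
have L y : I y -> ln (1 + branch v y) =
    mobius_log (q' / q) ((p' + q') / (p + q)) y + (ln (p + q) - ln q).
  move=> /[dup] Iy /andP[y0 y1].
  have ? : 0 <= p' * y by rewrite mulr_ge0.
  have ? : 0 <= q' * y by rewrite mulr_ge0.
  rewrite E // /mobius_log.
  have -> : 1 + (p + p' * y) / (q + q' * y) =
      (p + q + (p' + q') * y) / (q + q' * y) by field; lra.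
  have -> : 1 + (p' + q') / (p + q) * y = (p + q + (p' + q') * y) / (p + q) by field; lra.
  have -> : 1 + q' / q * y = (q + q' * y) / q by field; lra.
  rewrite !ln_div ?posrE; lra.
by move=> y z Iy Iz; rewrite !L //; lra.
Qed.

Lemma cyl_prob_sum_d1 (D : nat) v : (0 < D)%N -> posw v ->
  (3 / 8 - D%:R^-1) * cyl_prob R v <= \sum_(1 <= d < D) cyl_prob R (rcons (rcons v d) 1%N).
Proof.
move=> D0 pv; have [al [be [Ia Ib E]]] := ln_branch_mobius_log pv.
have L2 := @ln2_gt0 R.
have I0 : I 0 by rewrite lexx ler01.
have I1 : I 1 by rewrite lexx ler01.
rewrite /cyl_prob -mulr_suml mulrA ler_pM2r ?invr_gt0 //.
have -> : \sum_(1 <= d < D) `|ln (1 + branch (rcons (rcons v d) 1%N) 1) -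
       ln (1 + branch (rcons (rcons v d) 1%N) 0)| =
    \sum_(1 <= d < D) `|mobius_log al be (d%:R + 2^-1)^-1 - mobius_log al be (d%:R + 1)^-1|.
  rewrite !big_nat; apply: eq_bigr => d /andP[d0 _].
  rewrite -!cats1 -!catA !branch_cat /= addr0 invr1 -[(1 + 1 : R)]/(2 : R).
  by rewrite E //; apply: inv01 => //; apply/andP; split; lra.
rewrite E //.
(* Exchanging [al] and [be] only changes a sign inside the absolute values; which is larger depends
   on the parity of the length of v. *)
wlog ab : al be Ia Ib {E} / al <= be.
  move=> H; have [|/ltW ba] := leP al be; first exact: H.
  have QN y : mobius_log al be y = - mobius_log be al y by rewrite /mobius_log opprB.
  have := H be al Ib Ia ba; rewrite !QN -opprD normrN.
  by under [X in _ -> _ <= X]eq_bigr => d _ do rewrite !QN -opprD normrN.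
have /andP[a0 _] := Ia; have /andP[_ b1] := Ib.
rewrite ger0_norm.
  apply: le_trans (mobius_log_sum_ge D0 a0 ab b1) _.
  by apply: ler_sum => d _; exact: ler_norm.
by rewrite /mobius_log !mulr0 !mulr1 !addr0 subrr subr0 subr_ge0 ler_ln ?posrE; lra.
Qed.

Lemma cyl_prob_one : cyl_prob R [:: 1%N] = ln (4 / 3) / ln 2.
Proof.
rewrite /cyl_prob /= addr0 invr1; congr (_ / _).
have -> : 1 + (1 + 1)^-1 = 3 / 2 :> R by field.
rewrite distrC ger0_norm; last by rewrite subr_ge0 ler_ln ?posrE; lra.
by rewrite -ln_div ?posrE; [congr ln; field|lra|lra].
Qed.

Lemma cyl_prob_one_one : cyl_prob R [:: 1%N; 1%N] = ln (10 / 9) / ln 2.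
Proof.
rewrite /cyl_prob /= addr0 invr1; congr (_ / _).
have -> : 1 + (1 + (1 + 1)^-1)^-1 = 5 / 3 :> R by field.
have -> : 1 + (1 + 1)^-1 = 3 / 2 :> R by field.
rewrite ger0_norm; last by rewrite subr_ge0 ler_ln ?posrE; lra.
by rewrite -ln_div ?posrE; [congr ln; field|lra|lra].
Qed.

Lemma cyl_prob_one_one_lt : cyl_prob R [:: 1%N; 1%N] < 3 / 8 * cyl_prob R [:: 1%N].
Proof.
rewrite cyl_prob_one cyl_prob_one_one mulrA ltr_pM2r ?invr_gt0 ?ln2_gt0 //.
have : ln ((10 / 9 : R) ^+ 8) < ln ((4 / 3 : R) ^+ 3).
  by rewrite ltr_ln ?posrE ?exprn_gt0 //; lra.
by rewrite !lnXn; lra.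
Qed.

End PairWithOne.

(** * Averages along a sequence and finite sums over words *)

Definition avg (R : realType) (F : nat -> R) (n : nat) : R :=
  (\sum_(j < n) F j) / n%:R.

Definition window (b : nat -> nat) (j N : nat) : seq nat := [seq b i | i <- iota j N].

Fixpoint word_sum (R : realType) (D n : nat) (F : seq nat -> R) : R :=
  if n is n'.+1 then \sum_(1 <= d < D) word_sum D n' (fun w => F (d :: w)) else F [::].

Lemma cvg_sum (R : realType) (I : Type) (r : seq I) (A : pred I)
    (F : I -> nat -> R) (l : I -> R) :
  (forall i, A i -> F i n @[n --> \oo] --> l i) ->
  (\sum_(i <- r | A i) F i n) @[n --> \oo] --> \sum_(i <- r | A i) l i.
Proof.
move=> Fl; elim: r => [|i r ih].
  by rewrite big_nil; under eq_fun do rewrite big_nil; exact: cvg_cst.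
rewrite big_cons; under eq_fun do rewrite big_cons.
by case: ifPn => Ai //; apply: cvgD => //; exact: Fl.
Qed.

Section WordSums.
Variables (R : realType) (D : nat).
Implicit Types (F G : seq nat -> R).

Lemma word_sum_le n F G : (forall w, posw w -> size w = n -> F w <= G w) -> word_sum D n F <= word_sum D n G.
Proof.
elim: n F G => [|n ih] F G FG /=; first exact: FG.
rewrite !big_nat; apply: ler_sum => d /andP[d0 _]; apply: ih => w pw sw.
by apply: FG; rewrite /= ?d0 ?sw.
Qed.

Lemma word_sum_eq n F G : (forall w, posw w -> F w = G w) -> word_sum D n F = word_sum D n G.
Proof. by move=> FG; apply/eqP; rewrite eq_le; apply/andP; split; apply: word_sum_le => w /FG ->. Qed.

Lemma word_sum0 n : word_sum D n (fun=> 0) = 0 :> R.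
Proof. by elim: n => //= n ih; rewrite big1. Qed.

Lemma word_sum_ge0 n F : (forall w, posw w -> 0 <= F w) -> 0 <= word_sum D n F.
Proof. by move=> F0; rewrite -(word_sum0 n); apply: word_sum_le => w /F0. Qed.

Lemma word_sumZ n (a : R) F : word_sum D n (fun w => a * F w) = a * word_sum D n F.
Proof. by elim: n F => //= n ih F; rewrite mulr_sumr; apply: eq_bigr => d _; exact: ih. Qed.

Lemma word_sum_sum n (J : nat) (F : nat -> seq nat -> R) :
  word_sum D n (fun w => \sum_(j < J) F j w) = \sum_(j < J) word_sum D n (F j).
Proof.
by elim: n F => //= n ih F; rewrite exchange_big /=; apply: eq_bigr => d _;
  exact: (ih (fun j w => F j (d :: w))).
Qed.

Lemma word_sum_rcons n F :
  word_sum D n.+1 F = word_sum D n (fun v => \sum_(1 <= d < D) F (rcons v d)).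
Proof. by elim: n F => // n ih F; apply: eq_bigr => d _; exact: (ih (fun w => F (d :: w))). Qed.

Lemma word_sum_cons n F :
  word_sum D n.+1 F = \sum_(1 <= d < D) word_sum D n (fun w => F (d :: w)).
Proof. by []. Qed.

Lemma word_sum_cvg n (F : nat -> seq nat -> R) G :
  (forall w, posw w -> size w = n -> F k w @[k --> \oo] --> G w) ->
  word_sum D n (F k) @[k --> \oo] --> word_sum D n G.
Proof.
elim: n F G => [|n ih] F G FG /=; first exact: FG.
rewrite big_nat; under eq_fun do rewrite big_nat.
apply: cvg_sum => d /andP[d0 _]; apply: (ih (fun k w => F k (d :: w))) => w pw sw.
by apply: FG; rewrite /= ?d0 ?sw.
Qed.

Lemma word_sum_pick w0 G : posw w0 ->
  word_sum D (size w0) (fun w => (w0 == w)%:R * G w) =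
  if all (fun d => d < D)%N w0 then G w0 else 0.
Proof.
elim: w0 G => [|d0 w0 ih] G /=; first by rewrite mul1r.
move=> /andP[d00 pw].
transitivity (\sum_(1 <= d < D) if d == d0 then
    (if all (fun d => d < D)%N w0 then G (d :: w0) else 0) else 0).
  apply: eq_bigr => d _; rewrite eq_sym; case: eqP => [->|/eqP dd].
    by rewrite -(ih (fun w => G (d :: w))) //; apply: word_sum_eq => w _; rewrite eqseq_cons eqxx.
  by rewrite -[RHS](word_sum0 (size w0)); apply: word_sum_eq => w _; rewrite eqseq_cons (negbTE dd) mul0r.
by rewrite -big_mkcond big_nat1_eq d00 /=; case: (_ < D)%N.
Qed.

(** The paths of the chain through the merged symbol [D] are dropped; they contribute a nonnegative
    amount. *)
Lemma word_sum_le_expect n x G : (0 < D)%N -> 0 <= x <= 1 -> (forall w, 0 <= G w) ->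
  word_sum D n (fun w => word_prob x w * G w) <= expect D n x G.
Proof.
move=> D0; elim: n x G => [|n ih] x G x01 G0 /=; first by rewrite mul1r.
have i01 : 0 <= (0 : R) <= 1 by rewrite lexx ler01.
rewrite -[leLHS]addr0; apply: lerD; last first.
  rewrite mulr_ge0 ?tail_ge0 //; first by case/andP: x01.
  by rewrite -[leLHS](expect_cst D0 n 0 i01); apply: expect_le.
rewrite !big_nat; apply: ler_sum => d /andP[d0 _].
apply: le_trans (ler_wpM2l _ (ih _ (fun w => G (d :: w)) (inv01 d0 x01) _)).
- by rewrite -word_sumZ; apply: word_sum_le => w _ _; rewrite mulrA.
- by apply: digit_prob_ge0; case/andP: x01.
- by [].
Qed.

End WordSums.

Section Averages.
Variable R : realType.
Implicit Types (F G u v : nat -> R) (l p : R).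

Lemma avg_le_avg F G n : (forall j, F j <= G j) -> avg F n <= avg G n.
Proof. by move=> FG; rewrite /avg ler_wpM2r ?invr_ge0 // ler_sum. Qed.

Lemma avgD F G n : avg (fun j => F j + G j) n = avg F n + avg G n.
Proof. by rewrite /avg big_split mulrDl. Qed.

Lemma avg_sum (I : Type) (r : seq I) (F : I -> nat -> R) n :
  avg (fun j => \sum_(i <- r) F i j) n = \sum_(i <- r) avg (F i) n.
Proof. by rewrite /avg exchange_big mulr_suml. Qed.

Lemma cvg_cst_div (C : R) : C / n%:R @[n --> \oo] --> 0.
Proof.
rewrite -[0](mulr0 C); apply: cvgM; first exact: cvg_cst.
rewrite -cvg_shiftS; exact: cvg_harmonic.
Qed.

Lemma cvg_bdd_diff u v (C p : R) : (forall n, `|u n - v n| <= C) ->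
  v n / n%:R @[n --> \oo] --> p -> u n / n%:R @[n --> \oo] --> p.
Proof.
move=> uvC vp.
have d0 : u n / n%:R - v n / n%:R @[n --> \oo] --> 0.
  apply/norm_cvg0P; apply: (@squeeze_cvgr _ _ _ _ (fun=> 0) (fun n => C / n%:R)).
  - near=> n; rewrite normr_ge0 /= -mulrBl normrM normfV normr_nat.
    by rewrite ler_wpM2r ?invr_ge0.
  - exact: cvg_cst.
  - exact: cvg_cst_div.
rewrite -[p]add0r (_ : (fun n => _) = (fun n => (u n / n%:R - v n / n%:R) + v n / n%:R)).
  exact: cvgD.
by apply/funext => n; rewrite subrK.
Unshelve. all: by end_near. Qed.

Lemma sum_shift_dist F K k n : (forall j, `|F j| <= K) ->
  `|\sum_(j < n) F (j + k)%N - \sum_(j < n) F j| <= 2 * K * k%:R.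
Proof.
move=> FK; elim: k => [|k ih].
  by under eq_bigr do rewrite addn0; rewrite subrr normr0 mulr0.
have -> : \sum_(j < n) F (j + k.+1)%N = \sum_(j < n) F (j + k)%N + F (n + k)%N - F k.
  elim: n {ih} => [|n ih]; first by rewrite !big_ord0 add0n add0r subrr.
  by rewrite !big_ord_recr /= ih addnS -addSn; lra.
rewrite -natr1; move: ih (FK (n + k)%N) (FK k).
rewrite !ler_norml => /andP[? ?] /andP[? ?] /andP[? ?].
by apply/andP; split; lra.
Qed.

Lemma avg_shift F K k p : (forall j, `|F j| <= K) ->
  avg F n @[n --> \oo] --> p -> avg (fun j => F (j + k)%N) n @[n --> \oo] --> p.
Proof.
move=> FK; apply: (@cvg_bdd_diff _ _ (2 * K * k%:R)) => n.
exact: sum_shift_dist.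
Qed.

Lemma squeeze_small u : (forall e : R, 0 < e -> exists hi h, [/\
    forall n, `|u n| <= hi n, hi n @[n --> \oo] --> h & h < e]) ->
  u n @[n --> \oo] --> 0.
Proof.
move=> H; apply/cvgrPdist_lt => e e0; have [hi [h [uhi hih he]]] := H e e0.
have : \forall n \near \oo, hi n < e by apply: (cvgr_lt h) => //.
by apply: filterS => n; apply: le_lt_trans; rewrite sub0r normrN.
Qed.

(** At each truncation level the two bounds converge, but to limits that vary with the level. Only
    their gap becomes small, so the limit of u is obtained from the Cauchy criterion. *)
Lemma sandwich_is_cvg u : (forall e : R, 0 < e -> exists lo hi l h, [/\
    forall n, lo n <= u n <= hi n, lo n @[n --> \oo] --> l,
    hi n @[n --> \oo] --> h & h < l + e]) ->
  cvgn u.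
Proof.
move=> H; apply/cauchy_cvgP; apply: cauchy_exP => e e0.
have [lo [hi [l [h [luh lol hih he]]]]] := H e e0; exists l.
have A : \forall n \near \oo, hi n < l + e by apply: (cvgr_lt h).
have B : \forall n \near \oo, l - e < lo n by apply: (cvgr_gt l) => //; lra.
suff : \forall n \near \oo, ball l e (u n) by [].
apply: filterS2 A B => n ? ?; rewrite /ball /= ltr_norml; have /andP[? ?] := luh n.
by apply/andP; split; lra.
Qed.

End Averages.

(** * Word averages along a normal digit sequence *)

Section NormalDigits.
Variables (R : realType) (b : nat -> nat).
Hypothesis b_pos : forall i, (0 < b i)%N.
Hypothesis b_norm : forall s, posw s ->
  avg (fun j => (window b j (size s) == s)%:R) n @[n --> \oo] --> cyl_prob R s.
Implicit Types (D N m : nat) (G : seq nat -> R).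

Lemma size_window c j N : size (window c j N) = N.
Proof. by rewrite size_map size_iota. Qed.

Lemma nth_window c j N i : (i < N)%N -> nth 0%N (window c j N) i = c (j + i)%N.
Proof. by move=> iN; rewrite (nth_map 0%N) ?size_iota // nth_iota. Qed.

Lemma posw_window j N : posw (window b j N).
Proof. by rewrite all_map; apply/allP => i _; exact: b_pos. Qed.

(** Equals G of the window if all its digits are below D, and 0 otherwise ([low_partE]). As a finite
    combination of word indicators, its average converges by normality. *)
Definition low_part D N G (j : nat) : R :=
  word_sum D N (fun w => (window b j N == w)%:R * G w).

Definition tails D N (j : nat) : R := \sum_(i < N) (D <= b (j + i))%N%:R.

Lemma low_partE D N G j : low_part D N G j =
  if all (fun d => d < D)%N (window b j N) then G (window b j N) else 0.
Proof. by rewrite /low_part -{1}(size_window b j N) word_sum_pick // posw_window. Qed.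

Lemma low_part_le D N G j : (forall w, 0 <= G w) ->
  low_part D N G j <= G (window b j N).
Proof. by move=> G0; rewrite low_partE; case: ifP. Qed.

Lemma tails_ge0 D N j : 0 <= tails D N j.
Proof. by apply: sumr_ge0. Qed.

(** A window with a digit at least D has [tails] at least 1, so M times it already dominates g. *)
Lemma le_low_part_tails D N G j (g M : R) : 0 <= M -> g <= M ->
  (all (fun d => d < D)%N (window b j N) -> g <= G (window b j N)) ->
  g <= low_part D N G j + M * tails D N j.
Proof.
move=> M0 gM gG; rewrite low_partE; case: ifPn => [/gG g1|].
  by apply: le_trans g1 _; rewrite lerDl mulr_ge0 ?tails_ge0.
rewrite add0r all_map => /allPn /= [i]; rewrite mem_iota -leqNgt => /andP[ji iN] Db.
apply: le_trans gM _; rewrite -[leLHS]mulr1 ler_wpM2l //.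
have iN' : (i - j < N)%N by lia.
rewrite /tails (bigD1 (Ordinal iN')) //= subnKC // Db lerDl.
exact: sumr_ge0.
Qed.

Lemma cvg_low_part D N G :
  avg (low_part D N G) n @[n --> \oo] --> word_sum D N (fun w => cyl_prob R w * G w).
Proof.
rewrite (_ : avg _ = fun n =>
  word_sum D N (fun w => avg (fun j => (window b j N == w)%:R) n * G w)); last first.
  apply/funext => n; rewrite /avg /low_part.
  rewrite -(word_sum_sum D N n (fun j w => (window b j N == w)%:R * G w)) mulrC -word_sumZ.
  by apply: word_sum_eq => w _; rewrite mulr_suml mulr_sumr mulr_suml;
     apply: eq_bigr => j _; rewrite mulrCA mulrA.
apply: word_sum_cvg => w pw <-; apply: cvgM; [exact: b_norm|exact: cvg_cst].
Qed.

Definition tail_prob D : R := 1 - \sum_(1 <= d < D) cyl_prob R [:: d].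

Lemma cvg_tails D N : avg (tails D N) n @[n --> \oo] --> N%:R * tail_prob D.
Proof.
have one : avg (fun j => (D <= b j)%N%:R) n @[n --> \oo] --> tail_prob D.
  (* Large digits are counted as the complement of finitely many words. The constant 1 is written as
     the average for the empty word, which is 0 at n = 0, so that the identity holds there too. *)
  rewrite (_ : avg _ = fun n => avg (fun j => (window b j 0 == [::])%:R) n -
     \sum_(1 <= d < D) avg (fun j => (window b j 1 == [:: d])%:R) n); last first.
    apply/funext => n; rewrite -avg_sum /avg -mulrBl -sumrB; congr (_ / _).
    apply: eq_bigr => j _.
    transitivity (1 - \sum_(1 <= d < D) if d == b j then 1 else 0 : R).
      by rewrite -big_mkcond big_nat1_eq b_pos /= ltnNge; case: (_ <= _)%N;
         rewrite ?subr0 ?subrr.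
    congr (_ - _); apply: eq_bigr => d _.
    by rewrite /window /= eqseq_cons andbT eq_sym; case: eqP.
  have -> : tail_prob D = cyl_prob R [::] - \sum_(1 <= d < D) cyl_prob R [:: d].
    by rewrite /tail_prob /cyl_prob /= addr0 ln1 subr0 ger0_norm ?divff ?gt_eqF // ?ltW // ln2_gt0.
  apply: cvgB; first exact: b_norm.
  rewrite big_nat; under eq_fun do rewrite big_nat.
  by apply: cvg_sum => d /andP[d0 _]; apply: (b_norm (s := [:: d])); rewrite /= d0.
rewrite (_ : avg _ = fun n => \sum_(i < N) avg (fun j => (D <= b (j + i))%N%:R) n).
  rewrite -[N in N%:R]card_ord -sum1_card natr_sum mulr_suml.
  apply: cvg_sum => i _; rewrite mul1r.
  apply: (@avg_shift _ (fun j => (D <= b j)%N%:R) 1) => // j.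
  by case: (_ <= _)%N; rewrite ?normr1 ?normr0.
by apply/funext => n; rewrite -avg_sum.
Qed.

(** The measures of the one-digit cylinders telescope, leaving ln (1 + 1 / D) / ln 2. *)
Lemma tail_prob_le D : (0 < D)%N -> tail_prob D <= 2 / D%:R.
Proof.
move=> D0; have L := @ln2_gt0 R.
have pmd d : (0 < d)%N -> cyl_prob R [:: d] =
    (ln (1 + d%:R^-1) - ln (1 + d.+1%:R^-1)) / ln 2.
  move=> d0; rewrite /cyl_prob /= addr0 natr1 distrC ger0_norm // subr_ge0.
  have ? : 0 < d%:R^-1 :> R by rewrite invr_gt0 ltr0n.
  have ? : 0 < d.+1%:R^-1 :> R by rewrite invr_gt0 ltr0n.
  by rewrite ler_ln ?posrE ?addr_gt0 // lerD2l lef_pV2 ?posrE ?ltr0n // ler_nat.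
have S : \sum_(1 <= d < D) cyl_prob R [:: d] = 1 - ln (1 + D%:R^-1) / ln 2.
  case: D D0 => // n _; elim: n => [|n ih].
    by rewrite big_geq // invr1 divff ?gt_eqF // subrr.
  by rewrite big_nat_recr //= ih pmd //; lra.
rewrite /tail_prob S subKr ler_pdivrMr //.
have DV : 0 <= D%:R^-1 :> R by rewrite invr_ge0.
apply: le_trans (@le_ln1Dx _ _ _) _; first by lra.
by have := ler_wpM2l DV (@ln2_ge_half R); lra.
Qed.

Definition one_pair m (j : nat) : R := ((b j == 1%N) && (b (j + m) == 1%N))%:R.

Lemma ones_window m l j N : (l + m < N)%N ->
  ones R m l (window b j N) = one_pair m (j + l).
Proof. by move=> lN; rewrite /ones !nth_window // ?addnA //; lia. Qed.

Lemma ones_01 m l w : 0 <= ones R m l w <= 1.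
Proof. by rewrite /ones ler0n lern1 leq_b1. Qed.

Lemma one_pair_01 m j : 0 <= one_pair m j <= 1.
Proof. by rewrite /one_pair ler0n lern1 leq_b1. Qed.

Definition low_pair_prob D m : R := word_sum D m.+1 (fun w => cyl_prob R w * ones R m 0 w).

(** Additivity of the measure over the words that follow a 1, up to digits at least D. It is read
    off from b: the averages of both sides are compared and their limits taken. *)
Lemma cyl_prob_one_le D N : (1 < D)%N ->
  cyl_prob R [:: 1%N] - N.+1%:R * (2 / D%:R) <= word_sum D N (fun v => cyl_prob R (1%N :: v)).
Proof.
move=> D1; have D0 := ltnW D1.
pose G w : R := (nth 0%N w 0 == 1%N)%:R.
have -> : word_sum D N (fun v => cyl_prob R (1%N :: v)) = word_sum D N.+1 (fun w => cyl_prob R w * G w).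
  rewrite /= big_ltn // big_nat big1 ?addr0 => [|d /andP[d1 _]].
    by apply: word_sum_eq => w _; rewrite /G /= mulr1.
  by rewrite -[RHS](word_sum0 R D N); apply: word_sum_eq => w _; rewrite /G /= gtn_eqF //= mulr0n mulr0.
have h1 := @cvg_low_part D N.+1 G; have h2 := @cvg_tails D N.+1.
have h3 := b_norm (s := [:: 1%N]) isT.
have : cyl_prob R [:: 1%N] <= word_sum D N.+1 (fun w => cyl_prob R w * G w) + N.+1%:R * tail_prob D.
  apply: (ler_cvg_to h3 (cvgD h1 h2)); near=> n.
  rewrite /= -[X in _ <= X](avgD (low_part D N.+1 G)); apply: avg_le_avg => j.
  rewrite -[tails _ _ _]mul1r; apply: le_low_part_tails => //.
    by rewrite lern1 leq_b1.
  by rewrite /G nth_window // addn0 /window /= eqseq_cons andbT.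
have N0 : 0 <= N.+1%:R :> R by [].
have := ler_wpM2l N0 (tail_prob_le D0); move: (N.+1%:R * _) (N.+1%:R * _) => *; lra.
Unshelve. all: by end_near. Qed.

(** The m - 1 >= 1 digits between the two ones are split into a word v and one last digit d;
    [cyl_prob_sum_d1] sums over d, and [cyl_prob_one_le] over v. *)
Lemma low_pair_prob_ge D m : (1 < D)%N -> (1 < m)%N -> (3 / 8 - D%:R^-1 : R) >= 0 ->
  (3 / 8 - D%:R^-1) * (cyl_prob R [:: 1%N] - m%:R * (2 / D%:R)) <= low_pair_prob D m.
Proof.
case: m => [|[|m]] // D1 _ c0; have D0 := ltnW D1.
have nonneg w : 0 <= cyl_prob R w * ones R m.+2 0 w.
  by rewrite mulr_ge0 ?cyl_prob_ge0 //; have /andP[] := ones_01 m.+2 0 w.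
apply: (@le_trans _ _ (word_sum D m (fun v => (3 / 8 - D%:R^-1) * cyl_prob R (1%N :: v)))).
  rewrite word_sumZ ler_wpM2l //; apply: le_trans (cyl_prob_one_le m D1).
  rewrite lerD2l lerN2 ler_wpM2r ?divr_ge0 //.
  by rewrite ler_nat.
apply: (@le_trans _ _ (word_sum D m.+1 (fun v => cyl_prob R (1%N :: rcons v 1%N)))).
  rewrite [leRHS]word_sum_rcons; apply: word_sum_le => v pv sv.
  exact: (@cyl_prob_sum_d1 R D (1%N :: v)).
apply: (@le_trans _ _ (word_sum D m.+2 (fun v => cyl_prob R (1%N :: v) * ones R m.+2 0 (1%N :: v)))).
  rewrite [leRHS]word_sum_rcons; apply: word_sum_le => v pv sv; rewrite big_ltn // -[leLHS]addr0; apply: lerD.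
    by rewrite /ones /= nth_rcons sv ltnn eqxx mulr1.
  by apply: sumr_ge0 => d _.
rewrite /low_pair_prob [leRHS]word_sum_cons [leRHS]big_ltn // -[leLHS]addr0; apply: lerD => //.
by apply: sumr_ge0 => d _; apply: word_sum_ge0.
Qed.

(** For each D the average lies between two convergent ones whose limits differ by at most 2 (m + 1)
    / D. The lower limits obey [low_pair_prob_ge], whose error terms vanish as D grows. *)
Lemma one_pair_limit m : (1 < m)%N -> exists2 l : R,
  avg (one_pair m) n @[n --> \oo] --> l & 3 / 8 * cyl_prob R [:: 1%N] <= l.
Proof.
move=> m1; pose lo D := low_part D m.+1 (ones R m 0).
have lo_le D j : lo D j <= one_pair m j.
  rewrite -[in leRHS](addn0 j) -(@ones_window _ _ _ m.+1) //.
  by apply: low_part_le => w; have /andP[] := ones_01 m 0 w.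
have le_hi D j : one_pair m j <= lo D j + 1 * tails D m.+1 j.
  apply: le_low_part_tails => //; first by have /andP[] := one_pair_01 m j.
  by rewrite ones_window ?addn0.
have lo_cvg D : avg (lo D) n @[n --> \oo] --> low_pair_prob D m := @cvg_low_part D _ _.
have : cvgn (avg (one_pair m)).
  apply: sandwich_is_cvg => e e0.
  have [D [D0 De]] : exists D, (0 < D)%N /\ m.+1%:R * 2 / D%:R < e :> R.
    have [N _ HN] := cvgr_lt _ (cvg_cst_div (m.+1%:R * 2 : R)) _ e0.
    by exists N.+1; split=> //; apply: HN => /=.
  exists (avg (lo D)), (fun n => avg (lo D) n + avg (tails D m.+1) n),
    (low_pair_prob D m), (low_pair_prob D m + m.+1%:R * tail_prob D); split=> //.
  - move=> n; rewrite avg_le_avg //= -avgD; apply: avg_le_avg => j.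
    by rewrite -[tails _ _ _]mul1r.
  - by apply: cvgD => //; exact: cvg_tails.
  - rewrite ltrD2l; apply: le_lt_trans De.
    by rewrite -mulrA ler_wpM2l // tail_prob_le.
move=> /cvg_ex[l Fl]; exists l => //.
have lD D : low_pair_prob D m <= l.
  apply: (ler_cvg_to (lo_cvg D) Fl); near=> n.
  exact: avg_le_avg.
set p := cyl_prob R [:: 1%N].
have inv0 : D%:R^-1 @[D --> \oo] --> (0 : R).
  by rewrite -cvg_shiftS; exact: cvg_harmonic.
have : (3 / 8 - D%:R^-1) * (p - m%:R * (2 * D%:R^-1)) @[D --> \oo] -->
    (3 / 8 - 0) * (p - m%:R * (2 * 0)).
  apply: cvgM; first by apply: cvgB => //; exact: cvg_cst.
  apply: cvgB; first exact: cvg_cst.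
  apply: cvgM; first exact: cvg_cst.
  by apply: cvgM => //; exact: cvg_cst.
rewrite !mulr0 !subr0 => H; apply: (cvgr_to_le H); near=> D.
have D4 : (4 <= D)%N by near: D; exact: nbhs_infty_ge.
apply: le_trans (lD D); apply: low_pair_prob_ge => //; first by lia.
have : D%:R^-1 <= 4^-1 :> R by rewrite lef_pV2 ?posrE ?ltr0n ?ler_nat //; lia.
lra.
Unshelve. all: by end_near. Qed.

End NormalDigits.

(** * Averages against a periodic weight of mean zero *)

Section PeriodicWeight.
Variables (R : realType) (m : nat).
Hypothesis m_gt0 : (0 < m)%N.

Definition chi (j : nat) : R := m%:R * (m %| j)%N%:R - 1.

Let m1 : 1 <= m%:R :> R. Proof. by rewrite ler1n. Qed.

Lemma chi_norm_le j : `|chi j| <= m%:R.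
Proof.
have := m1; rewrite /chi ler_norml; case: (m %| j)%N => /= ?;
  by rewrite ?mulr1 ?mulr0n ?mulr0; apply/andP; split; lra.
Qed.

Lemma chi_modn j l : chi (j %% m + l) = chi (j + l).
Proof. by rewrite /chi /dvdn modnDml. Qed.

Lemma sum_chi n : \sum_(j < n.+1) chi j = m%:R - 1 - (n %% m)%:R.
Proof.
elim: n => [|n ih]; first by rewrite big_ord1 /chi dvdn0 mod0n mulr1 subr0.
rewrite big_ord_recr /= ih /chi modnS; case: ifPn => dv /=.
  suff -> : (n %% m)%:R = m%:R - 1 :> R by lra.
  rewrite -[in m%:R](prednK m_gt0) -natr1 addrK; congr (_%:R).
  have := ltn_pmod n m_gt0; have [lt _|] := ltnP (n %% m).+1 m; last by lia.
  by move: dv; rewrite /dvdn -addn1 -modnDml modn_small addn1.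
by rewrite -[(n %% m).+1%:R]natr1; lra.
Qed.

Lemma sum_chi_norm_le n : `|\sum_(j < n) chi j| <= m%:R.
Proof.
case: n => [|n]; first by have := m1; rewrite big_ord0 normr0; lra.
have := ltn_pmod n m_gt0; rewrite -(ltr_nat R) => lt; rewrite sum_chi ler_norml.
have : 0 <= (n %% m)%:R :> R by [].
by have := m1; move=> ? ?; apply/andP; split; lra.
Qed.

Lemma sum_multiples (F : nat -> R) n :
  \sum_(j < m * n) (m %| j)%N%:R * F j = \sum_(i < n) F (i * m)%N.
Proof.
elim: n => [|n ih]; first by rewrite muln0 !big_ord0.
rewrite mulnS addnC big_split_ord /= ih big_ord_recr /=; congr (_ + _).
rewrite (bigD1 (Ordinal m_gt0)) //= addn0 dvdn_mulr // mul1r mulnC big1 ?addr0 // => i.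
rewrite -val_eqE /= => i0; have := ltn_ord i.
by rewrite dvdn_addr ?dvdn_mull // => im; rewrite gtnNdvd ?lt0n // mul0r.
Qed.

End PeriodicWeight.

Lemma cvg_muln (R : realType) (u : nat -> R) (l : R) m : (0 < m)%N ->
  u n @[n --> \oo] --> l -> u (m * n)%N @[n --> \oo] --> l.
Proof.
move=> m0 ul; apply: (@cvg_comp _ _ _ (fun n => m * n)%N u _ \oo) => //.
move=> A [N _ HN]; exists N => // n /= Nn; apply: HN => /=.
exact: leq_trans Nn (leq_pmull _ m0).
Qed.

(** Replaces Cauchy-Schwarz: it bounds a first moment linearly by a second one, pointwise and before
    any limit is taken. *)
Lemma norm_le_addsqr (R : realType) (t d : R) : 0 < d -> `|t| <= d + t ^+ 2 / d.
Proof.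
move=> d0; rewrite -[t ^+ 2]real_normK ?num_real //.
have t0 : 0 <= `|t| by []; move: `|t| t0 => s s0.
have [sd|ds] := leP s d; first by rewrite -[leLHS]addr0 lerD // divr_ge0 ?sqr_ge0 // ltW.
rewrite -[leLHS]add0r lerD ?(ltW d0) // ler_pdivlMr // expr2 ler_wpM2l //.
exact: ltW.
Qed.

Section PeriodicAverage.
Variables (R : realType) (b : nat -> nat) (m : nat).
Hypothesis b_pos : forall i, (0 < b i)%N.
Hypothesis b_norm : forall s, posw s ->
  avg (fun j => (window b j (size s) == s)%:R) n @[n --> \oo] --> cyl_prob R s.
Hypothesis m_gt0 : (0 < m)%N.

Local Notation F := (one_pair R b m).
Local Notation chi := (chi R m).

(** Blocks start at every j and overlap, so that they are counted at all positions, as word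
    frequencies are. Each of the L shifts alters the sum only in boundary terms. *)
Lemma block_sum_dist (A : nat -> R) (K : R) L n : (forall j, `|A j| <= K) -> (0 < L)%N ->
  `|\sum_(j < n) A j| <=
  \sum_(j < n) `|L%:R^-1 * \sum_(l < L) A (j + l)%N| + 2 * K * L%:R.
Proof.
move=> AK L0; have L1 := natr_ge1 R L0.
have K0 : 0 <= K by apply: le_trans (AK 0%N).
have -> : \sum_(j < n) A j = \sum_(j < n) (L%:R^-1 * \sum_(l < L) A (j + l)%N) -
    L%:R^-1 * \sum_(l < L) (\sum_(j < n) A (j + l)%N - \sum_(j < n) A j).
  rewrite -mulr_sumr exchange_big /= -mulrBr sumrB subKr sumr_const card_ord.
  by rewrite -[(\sum_(j < n) A j) *+ L]mulr_natl mulKf // gt_eqF //; lra.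
apply: le_trans (ler_normB _ _) _; apply: lerD; first exact: ler_norm_sum.
rewrite normrM ger0_norm ?invr_ge0 // ler_pdivrMl; last by lra.
apply: le_trans (ler_norm_sum _ _ _) _.
apply: (@le_trans _ _ (\sum_(l < L) 2 * K * L%:R)).
  apply: ler_sum => l _; apply: le_trans (sum_shift_dist l n AK) _.
  rewrite ler_wpM2l ?mulr_ge0 // ler_nat; exact: ltnW.
by rewrite sumr_const card_ord -[leLHS]mulr_natl.
Qed.

(** The block at j carries weights of phase j mod m, but a function of the word alone cannot know j.
    Summing the squares over all phases r dominates the relevant one and costs a factor m. *)
Definition block_square (c : R) L (w : seq nat) : R :=
  \sum_(r < m) (\sum_(l < L) chi (r + l)%N * (ones R m l w - c)) ^+ 2.

Lemma block_square_ge0 c L w : 0 <= block_square c L w.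
Proof. by apply: sumr_ge0 => r _; exact: sqr_ge0. Qed.

Lemma block_square_le c L w : 0 <= c <= 1 ->
  block_square c L w <= m%:R * (L%:R * m%:R) ^+ 2.
Proof.
move=> /andP[c0 c1].
apply: (@le_trans _ _ (\sum_(r < m) (L%:R * m%:R) ^+ 2)); last first.
  by rewrite sumr_const card_ord -[leLHS]mulr_natl.
apply: ler_sum => r _; rewrite -real_normK ?num_real // ler_pXn2r ?nnegrE ?mulr_ge0 //.
apply: le_trans (ler_norm_sum _ _ _) _.
apply: (@le_trans _ _ (\sum_(l < L) m%:R)); last by rewrite sumr_const card_ord -[leLHS]mulr_natl.
apply: ler_sum => l _; rewrite normrM -[leRHS]mulr1; apply: ler_pM => //.
  exact: chi_norm_le.
have /andP[? ?] := ones_01 R m l w.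
by rewrite ler_norml; apply/andP; split; lra.
Qed.

Lemma low_part_block_square D L : (1 < D)%N ->
  word_sum D (L + m) (fun w => cyl_prob R w *
     block_square (iter L (transition D) (one_gap_prob D m) 0) L w) <=
  2 * (m%:R * (m%:R ^+ 2 * (1 + 2 * 2 ^+ m.+2) * L%:R)).
Proof.
move=> D1; have D0 := ltnW D1; set c := iter L _ _ _.
have I0 : 0 <= (0 : R) <= 1 by rewrite lexx ler01.
apply: (@le_trans _ _ (word_sum D (L + m) (fun w => 2 * (word_prob (0 : R) w * block_square c L w)))).
  apply: word_sum_le => w pw _; rewrite mulrA ler_wpM2r ?block_square_ge0 //.
  exact: cyl_prob_le_word_prob.
rewrite word_sumZ ler_wpM2l //.
apply: le_trans (word_sum_le_expect _ D0 I0 (block_square_ge0 c L)) _.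
rewrite (expect_sum D0 _ _ (fun r w => (\sum_(l < L) chi (r + l)%N * (ones R m l w - c)) ^+ 2)) //.
rewrite -[m in m%:R * (_ ^+ 2 * _ * _)]card_ord -sum1_card natr_sum mulr_suml.
apply: ler_sum => r _; rewrite mul1r.
apply: (@variance_ones R D m D1 m_gt0 L m%:R L 0 (fun l => chi (r + l)%N)) => // l.
exact: chi_norm_le.
Qed.

Lemma avg_chi : avg (fun j => chi j * F j) n @[n --> \oo] --> 0.
Proof.
have m1 := natr_ge1 R m_gt0.
(* Three contributions stay at or below d = e / 4: the threshold of [norm_le_addsqr], the variance
   (choice of L) and the large digits (choice of D, after L). *)
apply: squeeze_small => e e0; pose d := e / 4; have d0 : 0 < d by rewrite divr_gt0.
pose C : R := 2 * (m%:R * (m%:R ^+ 2 * (1 + 2 * 2 ^+ m.+2))).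
have [L [L0 LC]] : exists L, (0 < L)%N /\ C / d / L%:R < d.
  have [N _ HN] := cvgr_lt _ (cvg_cst_div (C / d)) _ d0.
  by exists N.+1; split=> //; apply: HN => /=.
have L1 := natr_ge1 R L0.
pose M : R := m%:R * (L%:R * m%:R) ^+ 2.
have M0 : 0 <= M by rewrite mulr_ge0 ?sqr_ge0.
pose B : R := M * (L + m)%:R * 2 / (L%:R ^+ 2 * d).
have [D [D1 DB]] : exists D, (1 < D)%N /\ B / D%:R < d.
  have [N _ HN] := cvgr_lt _ (cvg_cst_div B) _ d0.
  by exists N.+2; split=> //; apply: HN => /=; lia.
have D0 := ltnW D1.
pose c : R := iter L (transition D) (one_gap_prob D m) 0.
have c01 : 0 <= c <= 1 by exact: iter_transition_one_gap_01.
have /andP[c0 c1] := c01.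
pose G := block_square c L; pose N := (L + m)%N.
pose q : R := (L%:R ^+ 2 * d)^-1.
have q0 : 0 < q by rewrite invr_gt0 mulr_gt0 ?exprn_gt0 //; lra.
pose bD i := minn (b i) D.
have bD1 i : (bD i == 1%N) = (b i == 1%N) by rewrite /bD; apply/eqP/eqP; lia.
have ones_bD l j : (l < L)%N -> ones R m l (window bD j N) = F (j + l).
  by move=> lL; rewrite ones_window ?/one_pair ?bD1 //; rewrite /N; lia.
exists (fun n => d + q * (avg (low_part b D N G) n + M * avg (tails R b D N) n) +
   (2 * m%:R * L%:R + m%:R) / n%:R).
exists (d + q * (word_sum D N (fun w => cyl_prob R w * G w) + M * (N%:R * tail_prob R D)) + 0).
split.
- move=> n; case: n => [|n]; first rewrite /avg !big_ord0 !mul0r invr0 !mulr0 normr0 !addr0 ?mulr0 ?addr0.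
    by rewrite ltW.
  pose A j := chi j * (F j - c).
  have AK j : `|A j| <= m%:R.
    rewrite normrM -[leRHS]mulr1; apply: ler_pM => //; first exact: chi_norm_le.
    have /andP[? ?] := one_pair_01 R b m j.
    by rewrite ler_norml; apply/andP; split; lra.
  have n0 : 0 < n.+1%:R :> R by rewrite ltr0n.
  (* Centring at c costs c times a partial sum of [chi], which is at most m and disappears after
     division by n. *)
  have -> : avg (fun j => chi j * F j) n.+1 =
      (\sum_(j < n.+1) A j + c * \sum_(j < n.+1) chi j) / n.+1%:R.
    rewrite /avg mulr_sumr -big_split /=; congr (_ / _).
    by apply: eq_bigr => j _; rewrite /A; ring.
  rewrite normrM normfV normr_nat ler_pdivrMr // mulrDl mulfVK ?gt_eqF //.
  apply: le_trans (ler_normD _ _) _; rewrite addrA; apply: lerD; last first.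
    by rewrite normrM ger0_norm // -[leRHS]mul1r ler_pM // sum_chi_norm_le.
  apply: le_trans (block_sum_dist n.+1 AK L0) _; rewrite lerD2r.
  have pt j : `|L%:R^-1 * \sum_(l < L) A (j + l)%N| <=
      d + q * (low_part b D N G j + M * tails R b D N j).
    have S : \sum_(l < L) A (j + l)%N =
        \sum_(l < L) chi (j %% m + l)%N * (ones R m l (window bD j N) - c).
      by apply: eq_bigr => l _; rewrite /A chi_modn ones_bD.
    apply: le_trans (norm_le_addsqr _ d0) _; rewrite lerD2l.
    apply: (@le_trans _ _ (q * G (window bD j N))).
      rewrite exprMn exprVn mulrAC -invfM -/q ler_wpM2l ?(ltW q0) // S.
      rewrite /G /block_square (bigD1 (Ordinal (ltn_pmod j m_gt0))) //= lerDl.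
      by apply: sumr_ge0 => r _; exact: sqr_ge0.
    rewrite ler_wpM2l ?(ltW q0) //; apply: le_low_part_tails => //.
      exact: block_square_le.
    move=> /allP lo; suff -> : window bD j N = window b j N by [].
    apply/eq_in_map => i ij; rewrite /bD; apply/minn_idPl/ltnW/lo.
    by apply/mapP; exists i.
  apply: le_trans (ler_sum _ (fun (j : 'I_n.+1) _ => pt j)) _.
  rewrite big_split /= sumr_const card_ord -mulr_natr -mulr_sumr big_split /= -mulr_sumr.
  rewrite /avg le_eqVlt; apply/orP; left; apply/eqP; field.
  by rewrite gt_eqF.
- apply: cvgD; last exact: cvg_cst_div.
  apply: cvgD; first exact: cvg_cst.
  apply: cvgM; first exact: cvg_cst.
  apply: cvgD; first exact: cvg_low_part.
  by apply: cvgM; [exact: cvg_cst|exact: cvg_tails].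
- have h1 : q * word_sum D N (fun w => cyl_prob R w * G w) <= C / d / L%:R.
    apply: le_trans (ler_wpM2l (ltW q0) (low_part_block_square L D1)) _.
    rewrite le_eqVlt; apply/orP; left; apply/eqP; rewrite /q /C.
    by move: (2 ^+ _) => z; field; rewrite !gt_eqF //; lra.
  have h2 : q * (M * (N%:R * tail_prob R D)) <= B / D%:R.
    rewrite (_ : B / D%:R = q * (M * (N%:R * (2 / D%:R)))).
      rewrite !ler_wpM2l ?(ltW q0) //; exact: tail_prob_le.
    by rewrite /B /q /N; ring.
  have e4 : e = 4 * d by rewrite /d; field.
  rewrite mulrDr addr0 e4; lra.
Qed.

End PeriodicAverage.

(** * From orbit counts to averages, and the theorem *)

Lemma sum_count (R : realType) (Q : pred nat) n :
  (count Q (iota 0 n))%:R = \sum_(i < n) (Q i)%:R :> R.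
Proof.
elim: n => [|n ih]; first by rewrite big_ord0.
by rewrite -addn1 iotaD count_cat natrD ih addn1 big_ord_recr /= addn0.
Qed.

(** Starting at digit k shifts positions by k - 1, and [CF_normal] counts one index more; both
    change the count by a bounded amount. The empty word, on which [CF_normal] is silent, is done by
    hand. *)
Lemma CF_normal_avg (R : realType) (a : nat -> nat) k :
  (forall i, (0 < i)%N -> (0 < a i)%N) -> (0 < k)%N -> CF_normal (cf R a) ->
  forall s, posw s ->
  avg (fun j => (window (fun i => a (k + i)%N) j (size s) == s)%:R) n @[n --> \oo]
    --> cyl_prob R s.
Proof.
move=> a0 k0 na s ps; have [->|s0] := eqVneq s [::].
  have -> : cyl_prob R [::] = 1.
    by rewrite /cyl_prob /= addr0 ln1 subr0 ger0_norm ?divff ?gt_eqF // ?ltW // ln2_gt0.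
  rewrite /avg -cvg_shiftS (_ : (fun n => _) = fun=> 1); first exact: cvg_cst.
  by apply/funext => n; rewrite /= sumr_const card_ord divff.
pose X i : R := ([seq a j | j <- iota i.+1 (size s)] == s)%:R.
have := na s s0 ps; rewrite gauss_measure_cylinder //.
apply: (@cvg_bdd_diff _ _ _ (2 * 1 * k.-1%:R + 1)) => n.
rewrite sum_count (eq_bigr (fun i : 'I_n.+1 => X i)); last first.
  by move=> i _; rewrite iter_gauss_cylinder.
rewrite (eq_bigr (fun j : 'I_n => X (j + k.-1)%N)); last first.
  move=> j _; rewrite /X /window -addnS prednK // addnC iotaDl -map_comp.
  by rewrite -(addn0 j) iotaDl.
rewrite big_ord_recr /= opprD addrA.
have X1 j : `|X j| <= 1 by rewrite /X; case: eqP; rewrite ?normr1 ?normr0.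
by apply: le_trans (ler_normB _ _) _; rewrite lerD // sum_shift_dist.
Qed.

Theorem theorem1 (R : realType) (x : R) (a : nat -> nat)
    (x01 : 0 <= x < 1) (x_irr : irrational x)
    (a_pos : forall i : nat, (1 <= i)%N -> (0 < a i)%N)
    (x_cf : x = cf R a) (x_normal : CF_normal x)
    (k m : nat) (k_ge1 : (1 <= k)%N) (m_ge2 : (2 <= m)%N) :
  ~ CF_normal (cf R (fun i : nat => a ((i - 1) * m + k)%N)) /\
  exists2 l : R,
    (count (fun i : nat => (a ((i - 1) * m + k)%N == 1%N) &&
                           (a (i * m + k)%N == 1%N))
       (iota 1 n))%:R / n%:R @[n --> \oo] --> l &
    l <> gauss_measure (cylinder R [:: 1%N; 1%N]).
Proof.
pose b i := a (k + i)%N.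
have b_pos i : (0 < b i)%N by rewrite a_pos // addn_gt0 k_ge1.
have m_gt0 : (0 < m)%N by exact: ltnW.
have b_norm s : posw s ->
    avg (fun j => (window b j (size s) == s)%:R) n @[n --> \oo] --> cyl_prob R s.
  by apply: CF_normal_avg => //; rewrite -x_cf.
have [l Fl l_ge] := one_pair_limit b_pos b_norm m_ge2.
have chi0 := avg_chi b_pos b_norm m_gt0.
have l_neq : l <> gauss_measure (cylinder R [:: 1%N; 1%N]).
  by rewrite gauss_measure_cylinder // => l11; have := cyl_prob_one_one_lt R; lra.
have lim : (\sum_(i < n) one_pair R b m (i * m)%N) / n%:R @[n --> \oo] --> l.
  (* Since chi j + 1 is m at the multiples of m and 0 elsewhere, averaging it against the pairs over
     j < m n gives the average over n multiples of m. *)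
  rewrite -[l]add0r (_ : (fun n => _) = fun n =>
      avg (fun j => chi R m j * one_pair R b m j) (m * n) +
      avg (one_pair R b m) (m * n)).
    by apply: cvgD; apply: (cvg_muln m_gt0).
  apply/funext => n.
  rewrite -(avgD (fun j => chi R m j * one_pair R b m j)) /avg.
  rewrite -(sum_multiples m_gt0) [in RHS](eq_bigr (fun j : 'I_(m * n) =>
      m%:R * ((m %| j)%N%:R * one_pair R b m j))); last first.
    by move=> j _; rewrite /chi; ring.
  rewrite -mulr_sumr natrM invfM mulrACA divff ?mul1r //.
  by rewrite pnatr_eq0 -lt0n.
have cnt n : (count (fun i : nat => (a ((i - 1) * m + k)%N == 1%N) &&
    (a (i * m + k)%N == 1%N)) (iota 1 n))%:R = \sum_(i < n) one_pair R b m (i * m)%N.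
  rewrite (iotaDl 1 0) count_map sum_count; apply: eq_bigr => i _ /=.
  rewrite add1n subn1 /one_pair /b /=.
  have -> : (i * m + k = k + i * m)%N by lia.
  by have -> : (i.+1 * m + k = k + (i * m + m))%N by lia.
split; last by exists l => //; under eq_fun do rewrite cnt.
move=> ny; apply: l_neq; apply: (cvg_unique _ lim).
  exact: norm_hausdorff.
set c := fun i => a ((i - 1) * m + k)%N in ny.
have c0 i : (0 < i)%N -> (0 < c i)%N by move=> _; rewrite a_pos // addn_gt0 k_ge1 orbT.
have := ny [:: 1%N; 1%N] isT isT.
(* The count for y runs over n + 1 positions, one more than the sum in [lim]; the extra term is at
   most 1. *)
apply: (@cvg_bdd_diff _ _ _ 1) => n.
rewrite sum_count (eq_bigr (fun i : 'I_n.+1 => one_pair R b m (i * m)%N)); last first.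
  move=> i _; rewrite iter_gauss_cylinder //= /c /one_pair /b.
  rewrite !eqseq_cons andbT !subn1 /=.
  have -> : (i * m + k = k + i * m)%N by lia.
  by have -> : (i.+1 * m + k = k + (i * m + m))%N by lia.
rewrite big_ord_recr /= opprD addNKr normrN.
have /andP[? ?] := one_pair_01 R b m (n * m).
by rewrite ger0_norm.
Qed.
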